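(* For every $\kappa^2>0$, \[ \int_{-\pi}^{\pi}|\partial_t\mathbf{u}|^2\,dt+\kappa^2\int_{-\pi}^{\pi}|\mathbf{u}\times\mathbf{n}|^2\,dt\ \ge\ c_\kappa^2\int_{-\pi}^{\pi}|\mathbf{u}|^2\,dt\qquad\forall\,\mathbf{u}\in H^1_\sharp([-\pi,\pi],\mathbb{R}^3), \] where the best constant is \[ c_\kappa^2=\begin{cases}1 & \text{if }\kappa^2\ge3,\\ \tfrac12(\kappa^2-\omega_\kappa^2+4) & \text{if }0<\kappa^2\le3,\end{cases}\qquad \omega_\kappa^2=\sqrt{\kappa^4+16}. \] Moreover, among $\mathbf{u}\in H^1_\sharp([-\pi,\pi],\mathbb{R}^3)$ normalized by $\frac{1}{2\pi}\int_{-\pi}^{\pi}|\mathbf{u}|^2\,dt=1$, equality holds if and only if $\mathbf{u}$ has third component identically zero and: (i) if $\kappa^2>3$: $\mathbf{u}=\pm\mathbf{n}$; (ii) if $\kappa^2=3$: $\mathbf{u}(t)=\sqrt2\rho_1\cos(\theta+t)\boldsymbol{\tau}(t)+\big[\pm\sqrt{1-5\rho_1^2}+2\sqrt2\rho_1\sin(\theta+t)\big]\mathbf{n}(t)$ for some $\theta\in[-\pi,\pi]$, $0\le\rho_1\le1/\sqrt5$ and some choice of sign (in particular $\pm\mathbf{n}$ are equality cases, corresponding to $\rho_1=0$); (iii) if $0<\kappa^2<3$: $\mathbf{u}(t)=\sqrt2(\sin\phi_\kappa)\cos(\theta+t)\boldsymbol{\tau}(t)+\sqrt2(\cos\phi_\kappa)\sin(\theta+t)\mathbf{n}(t)$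 for some $\theta\in[-\pi,\pi]$, where $\phi_\kappa=\frac12\arctan(4/\kappa^2)\in[0,\pi/2]$. In particular, for $0<\kappa^2<3$ there is no $\mathbf{u}$ with $|\mathbf{u}|=1$ a.e. attaining equality.
   Context: $H^1_\sharp([-\pi,\pi],\mathbb{R}^3)$ denotes the Sobolev space of $2\pi$-periodic $H^1$ functions $[-\pi,\pi]\to\mathbb{R}^3$ (identified with $H^1(\mathbb{S}^1,\mathbb{R}^3)$ via the parameterization $t\mapsto(\cos t,\sin t)$ of the unit circle). $\mathbf{n}(t)=(\cos t,\sin t,0)$ and $\boldsymbol{\tau}(t)=\partial_t\mathbf{n}(t)=(-\sin t,\cos t,0)$. *)

(* Defs.v *)
From HB Require Import structures.
From mathcomp Require Import all_boot all_order all_algebra.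
From mathcomp Require Import all_classical all_reals all_analysis.
Set Implicit Arguments. Unset Strict Implicit. Unset Printing Implicit Defensive.
Import Order.TTheory GRing.Theory Num.Theory.
Local Open Scope classical_set_scope.
Local Open Scope ring_scope.

Section Defs.
Variable R : realType.

Definition vec3 := (R * R * R)%type.
Definition v1 (v : vec3) : R := v.1.1.
Definition v2 (v : vec3) : R := v.1.2.
Definition v3 (v : vec3) : R := v.2.
Definition vdot (u v : vec3) : R := v1 u * v1 v + v2 u * v2 v + v3 u * v3 v.
Definition vnorm2 (u : vec3) : R := vdot u u.
Definition vcross (u v : vec3) : vec3 :=
  (v2 u * v3 v - v3 u * v2 v, v3 u * v1 v - v1 u * v3 v, v1 u * v2 v - v2 u * v1 v).
Definition vadd (u v : vec3) : vec3 := (v1 u + v1 v, v2 u + v2 v, v3 u + v3 v).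
Definition vscale (a : R) (u : vec3) : vec3 := (a * v1 u, a * v2 u, a * v3 u).
Definition vopp (u : vec3) : vec3 := vscale (-1) u.

Definition nvec (t : R) : vec3 := (cos t, sin t, 0).
Definition tauvec (t : R) : vec3 := (- sin t, cos t, 0).

Definition Ipi : set R := `[(- pi)%R, pi]%classic.
Definition leb := (@lebesgue_measure R).

Definition Ipi_int (f : R -> R) : R := Rintegral leb Ipi f.

(* g is the (weak) derivative of the 2pi-periodic H^1 function f on [-pi,pi]:
   g is measurable and square integrable on [-pi,pi], f is (the absolutely
   continuous representative) f(t) = f(-pi) + int_{-pi}^t g, and f(pi) = f(-pi). *)
Definition H1per_deriv (f g : R -> R) : Prop :=
  [/\ measurable_fun Ipi g,
      leb.-integrable Ipi (fun t => (g t)%:E),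
      leb.-integrable Ipi (fun t => (g t ^+ 2)%:E),
      (forall t, - pi <= t <= pi ->
         f t = f (- pi) + Rintegral leb `[(- pi)%R, t]%classic g)
    & f pi = f (- pi)].

Definition H1sharp3 (u du : R -> vec3) : Prop :=
  [/\ H1per_deriv (fun t => v1 (u t)) (fun t => v1 (du t)),
      H1per_deriv (fun t => v2 (u t)) (fun t => v2 (du t))
    & H1per_deriv (fun t => v3 (u t)) (fun t => v3 (du t))].

Definition energy (k2 : R) (u du : R -> vec3) : R :=
  Ipi_int (fun t => vnorm2 (du t)) + k2 * Ipi_int (fun t => vnorm2 (vcross (u t) (nvec t))).

Definition L2sq (u : R -> vec3) : R := Ipi_int (fun t => vnorm2 (u t)).

Definition omega2 (k2 : R) : R := Num.sqrt (k2 ^+ 2 + 16).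

Definition c2 (k2 : R) : R :=
  if 3 <= k2 then 1 else (k2 - omega2 k2 + 4) / 2.

Definition phik (k2 : R) : R := atan (4 / k2) / 2.

Definition equality_case (k2 : R) (u : R -> vec3) : Prop :=
  (forall t, Ipi t -> v3 (u t) = 0) /\
  (if 3 < k2 then
     (forall t, Ipi t -> u t = nvec t) \/ (forall t, Ipi t -> u t = vopp (nvec t))
   else if k2 == 3 then
     exists theta rho1 s, [/\ - pi <= theta <= pi, 0 <= rho1 <= 1 / Num.sqrt 5,
        (s = 1 \/ s = -1) &
        forall t, Ipi t -> u t =
          vadd (vscale (Num.sqrt 2 * rho1 * cos (theta + t)) (tauvec t))
               (vscale (s * Num.sqrt (1 - 5 * rho1 ^+ 2)
                        + 2 * Num.sqrt 2 * rho1 * sin (theta + t)) (nvec t))]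
   else
     exists theta, - pi <= theta <= pi /\
        forall t, Ipi t -> u t =
          vadd (vscale (Num.sqrt 2 * sin (phik k2) * cos (theta + t)) (tauvec t))
               (vscale (Num.sqrt 2 * cos (phik k2) * sin (theta + t)) (nvec t))).

End Defs.

(* Main.v *)
(* Write u = a tau + b n + w e3.  Since n' = tau and tau' = - n, the energy minus
   (2 - d) times the L2 norm, with d = 2 - c_kappa^2, becomes after integration
   by parts (int a' b = - int a b') a quadratic form in (a, b, w).  With zero-mean
   parts a0, b0, its (a, b) part is
     int (2/d a0 - b')^2 + (d - 1) int (2/d a' + b0)^2
     + (1 - 2/d)^2 (int a'^2 - int a0^2) + (kappa^2 + d - 4/d) int a0^2
   plus nonnegative multiples of the squared means, where d^2 + kappa^2 d = 4
   (so the last coefficient vanishes) if kappa^2 <= 3 and d = 1 if kappa^2 >= 3.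
   Everything thus follows from Wirtinger's inequality for a0 and its equality
   case.  The latter is obtained by splitting off the Fourier modes 1 and 2: the
   remainder satisfies 2 pi rho(t) = int K_t rho', where K_t is the component of
   a sawtooth kernel orthogonal to these modes and int K_t^2 = 2/3 pi^3 - 5 pi.
   Expanding int (rho' - rho(t) K_t)^2 >= 0 gives
   int rho'^2 >= (9 pi - 2/3 pi^3) rho(t)^2, with 9 pi - 2/3 pi^3 > 2 pi. *)
Require Import Defs.
From HB Require Import structures.
From mathcomp Require Import all_boot all_order all_algebra.
From mathcomp Require Import all_classical all_reals all_analysis.
From mathcomp Require Import measurable_realfun ring lra.
Set Implicit Arguments. Unset Strict Implicit. Unset Printing Implicit Defensive.
Import Order.TTheory GRing.Theory Num.Theory.
Import numFieldNormedType.Exports.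
Local Open Scope classical_set_scope.
Local Open Scope ring_scope.

(** * Integration by parts for absolutely continuous functions *)

Section Primitive.
Context {R : realType}.
Implicit Types (a b t : R) (f g phi psi : R -> R).
Notation mu := (@lebesgue_measure R).

Definition primitive_on a b f g : Prop :=
  mu.-integrable `[a, b] (EFin \o g) /\
  forall t, a <= t <= b -> f t = f a + \int[mu]_(s in `[a, t]) g s.

Lemma primitive_on_sub a b t f g : a <= t <= b ->
  primitive_on a b f g -> primitive_on a t f g.
Proof.
move=> /andP[at_ tb] [ig fg]; split.
  by apply: integrableS ig => //; apply: subset_itvl; rewrite bnd_simp.
by move=> s /andP[as_ st]; apply: fg; rewrite as_ (le_trans st).
Qed.

Lemma primitive_on_continuous a b f g : a <= b ->
  primitive_on a b f g -> {within `[a, b], continuous f}.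
Proof.
move=> ab [ig fg].
have h := parameterized_integral_continuous ab ig.
apply: (@subspace_eq_continuous _ _ _
  (fun t => f a + parameterized_integral mu a t g)).
  by move=> t /set_mem /=; rewrite in_itv /= => tab; exact/esym/fg.
move=> t; apply: cvgD; [exact: cvg_cst|exact: h].
Qed.

Lemma within_continuous_bounded a b phi : {within `[a, b], continuous phi} ->
  [bounded phi x | x in `[a, b]].
Proof.
move=> cphi.
have /compact_bounded := continuous_compact cphi (@segment_compact _ a b).
move=> [M [Mr Mb]]; exists M; split => // x Mx y yab.
by apply: (Mb x Mx); exists y.
Qed.

Lemma within_continuous_measurable a b phi : {within `[a, b], continuous phi} ->
  measurable_fun `[a, b] phi.
Proof. by move=> ?; apply: subspace_continuous_measurable_fun. Qed.

Lemma integrable_mul_continuous a b g phi :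
  mu.-integrable `[a, b] (EFin \o g) -> {within `[a, b], continuous phi} ->
  mu.-integrable `[a, b] (EFin \o (fun t => g t * phi t)).
Proof.
move=> ig cphi.
apply: (@integrableMl _ _ _ mu _ _ _ phi ig) => //.
  exact: within_continuous_measurable.
exact: within_continuous_bounded.
Qed.

Lemma integrable_addr (D : set (measurableTypeR R)) f g : measurable D ->
  mu.-integrable D (EFin \o f) -> mu.-integrable D (EFin \o g) ->
  mu.-integrable D (EFin \o (fun x => f x + g x)).
Proof. by move=> mD fi gi; have := integrableD mD fi gi; apply: eq_integrable. Qed.

Lemma integrable_scaler (D : set (measurableTypeR R)) (c : R) f : measurable D ->
  mu.-integrable D (EFin \o f) -> mu.-integrable D (EFin \o (fun x => c * f x)).
Proof. by move=> mD fi; have := integrableZl mD c fi; apply: eq_integrable. Qed.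

Lemma primitive_on_tail a b t f g : a <= t <= b -> primitive_on a b f g ->
  \int[mu]_(s in `[t, b]) g s = f b - f t.
Proof.
move=> /andP[at_ tb] [ig fg].
have ab := le_trans at_ tb.
have -> : f b - f t =
    \int[mu]_(s in `[a, b]) g s - \int[mu]_(s in `[a, t]) g s.
  by rewrite (fg b) ?ab ?lexx// (fg t) ?at_ ?tb//; ring.
rewrite Rintegral_itvB//.
rewrite Rintegral_itv_obnd_cbnd//.
apply: integrableS ig => //.
by apply: subset_itvr; rewrite bnd_simp.
Qed.

Lemma integralE_Rintegral (D : set (measurableTypeR R)) f : measurable D ->
  mu.-integrable D (EFin \o f) ->
  (\int[mu]_(s in D) (f s)%:E)%E = (\int[mu]_(s in D) f s)%:E.
Proof. by move=> mD fi; rewrite /Rintegral fineK//; exact: integrable_fin_num. Qed.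

Lemma measurable_le_pair : measurable [set z : R * R | z.1 <= z.2].
Proof.
rewrite [X in measurable X](_ : _ = [set: R * R] `&`
    (fun z : R * R => z.1 <= z.2) @^-1` [set true]); last first.
  by rewrite setTI; apply/seteqP; split => z /=.
have h := @measurable_fun_ler _ _ R setT _ _ measurable_fst measurable_snd.
exact: (h measurableT [set true]).
Qed.

(** Extending by zero to the whole plane lets Fubini's theorem be applied on [setT], with the
    triangle encoded by an indicator. *)
Let H a b g psi (z : R * R) : R :=
  (g \_ `[a, b]) z.1 * (psi \_ `[a, b]) z.2 * \1_[set z : R * R | z.1 <= z.2] z.

Let HE a b g psi s t : H a b g psi (s, t) =
  if [&& a <= s <= b, a <= t <= b & s <= t] then g s * psi t else 0.
Proof.
rewrite /H /= !patchE indicE.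
have -> : ((s, t) \in [set z : R * R | z.1 <= z.2]) = (s <= t).
  by apply/idP/idP => [/set_mem|?]//; apply/mem_set.
rewrite !mem_setE !in_itv/=.
case: (a <= s <= b) => /=; last by rewrite !mul0r.
case: (a <= t <= b) => /=; last by rewrite mulr0 mul0r.
by case: (s <= t); rewrite ?mulr1 ?mulr0.
Qed.

(** By Tonelli it suffices to bound the iterated integral of the absolute value. The indicator is at
    most 1, so this is at most the product of the L1 norms of [g] and [psi]. *)
Lemma kernel_integrable a b g psi :
  mu.-integrable `[a, b] (EFin \o g) -> mu.-integrable `[a, b] (EFin \o psi) ->
  (mu \x mu)%E.-integrable setT (EFin \o H a b g psi).
Proof.
move=> ig ipsi.
have ig0 : mu.-integrable setT (EFin \o (g \_ `[a, b])).
  by rewrite -restrict_EFin; apply: (proj1 (integrable_mkcond _ _)) => //.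
have ip0 : mu.-integrable setT (EFin \o (psi \_ `[a, b])).
  by rewrite -restrict_EFin; apply: (proj1 (integrable_mkcond _ _)) => //.
have mg0 : measurable_fun setT (g \_ `[a, b]).
  by apply/measurable_EFinP; exact: measurable_int ig0.
have mp0 : measurable_fun setT (psi \_ `[a, b]).
  by apply/measurable_EFinP; exact: measurable_int ip0.
have mH : measurable_fun setT (H a b g psi).
  apply: measurable_funM; first apply: measurable_funM.
  - by apply: measurableT_comp => //; exact: measurable_fst.
  - by apply: measurableT_comp => //; exact: measurable_snd.
  - by apply: measurable_indic; exact: measurable_le_pair.
apply/integrable12ltyP; first exact/measurable_EFinP.
set g0 := g \_ `[a, b] in mg0 ig0 *.
set p0 := psi \_ `[a, b] in mp0 ip0 *.
pose C := (\int[mu]_y `|(p0 y)%:E|)%E.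
have Cfin : C \is a fin_num.
  have := integrable_abse ip0.
  by move/(integrable_fin_num measurableT).
apply: (@le_lt_trans _ _ (\int[mu]_x (`|(g0 x)%:E| * C))%E).
  apply: ge0_le_integral => //.
  - by move=> x _; apply: integral_ge0.
  - have mabs : measurable_fun [set: measurableTypeR R * measurableTypeR R]
        (abse \o (EFin \o H a b g psi)).
      by apply: measurableT_comp => //; exact/measurable_EFinP.
    exact: (@measurable_fun_fubini_tonelli_F _ _ (measurableTypeR R)
      (measurableTypeR R) R (@lebesgue_measure R) _ mabs (fun z => abse_ge0 _)).
  - apply: emeasurable_funM; last exact: measurable_cst.
    by apply: measurableT_comp => //; exact/measurable_EFinP.
  - move=> x _.
    rewrite -ge0_integralZl//; last first.
      by apply: measurableT_comp => //; exact/measurable_EFinP.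
    apply: ge0_le_integral => //.
    + apply: measurableT_comp => //; apply/measurable_EFinP.
      by apply: (measurableT_comp mH); exact: pair1_measurable.
    + apply: emeasurable_funM; first exact: measurable_cst.
      by apply: measurableT_comp => //; exact/measurable_EFinP.
    + move=> y _ /=; rewrite /H /= -/g0 -/p0 -EFinM.
      rewrite lee_fin -normrM [leLHS]normrM ler_piMr//.
      by rewrite indicE; case: (_ \in _); rewrite ?normr1 ?normr0.
rewrite ge0_integralZr//.
- rewrite lte_mul_pinfty//; first exact: integral_ge0.
    have /(integrable_fin_num measurableT) := integrable_abse ig0; by [].
  by rewrite ltey_eq Cfin.
- by apply: measurableT_comp => //; exact/measurable_EFinP.
- exact: integral_ge0.
Qed.

(* [\int g * (phi b - phi)] and [\int psi * (f - f a)] are the two iterated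
   integrals of [g s * psi t] over the triangle [a <= s <= t <= b]. *)
Lemma primitive_on_by_parts a b f g phi psi : a <= b ->
  primitive_on a b f g -> primitive_on a b phi psi ->
  \int[mu]_(t in `[a, b]) (g t * phi t) + \int[mu]_(t in `[a, b]) (f t * psi t)
  = f b * phi b - f a * phi a.
Proof.
move=> ab Pf Pphi.
have [ig fg] := Pf; have [ipsi phipsi] := Pphi.
have cf := primitive_on_continuous ab Pf.
have cphi := primitive_on_continuous ab Pphi.
have igphi := integrable_mul_continuous ig cphi.
have ifpsi := integrable_mul_continuous ipsi cf.
have L : (\int[mu]_x \int[mu]_y (EFin \o H a b g psi) (x, y))%E =
    (\int[mu]_(s in `[a, b]) (g s * (phi b - phi s)))%:E.
  rewrite -integralE_Rintegral//; last first.
    have -> : (fun s => g s * (phi b - phi s)) =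
       (fun s => phi b * g s + (- 1) * (g s * phi s)) by apply/funext => s; ring.
    by apply: integrable_addr => //; exact: integrable_scaler.
  rewrite [RHS]integral_mkcond; apply: eq_integral => s _.
  rewrite patchE mem_setE in_itv/=; case: ifPn => sab; last first.
    by rewrite integral0_eq// => t _; rewrite /= HE (negPf sab).
  have [as_ sb] := andP sab.
  have ipsi' : mu.-integrable `[s, b] (EFin \o psi).
    by apply: integrableS ipsi => //; apply: subset_itvr; rewrite bnd_simp.
  rewrite -(primitive_on_tail sab Pphi) EFinM -integralE_Rintegral//.
  rewrite -integralZl//.
  rewrite [RHS]integral_mkcond; apply: eq_integral => t _.
  rewrite /= HE patchE mem_setE in_itv/= sab /=.
  have [st|] := leP s t; last by rewrite andbF.
  by rewrite (le_trans as_ st)/= andbT; case: ifP.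
have L' : (\int[mu]_y \int[mu]_x (EFin \o H a b g psi) (x, y))%E =
    (\int[mu]_(t in `[a, b]) (psi t * (f t - f a)))%:E.
  rewrite -integralE_Rintegral//; last first.
    have -> : (fun t => psi t * (f t - f a)) =
       (fun t => psi t * f t + (- f a) * psi t) by apply/funext => t; ring.
    by apply: integrable_addr => //; exact: integrable_scaler.
  rewrite [RHS]integral_mkcond; apply: eq_integral => t _.
  rewrite patchE mem_setE in_itv/=; case: ifPn => tab; last first.
    by rewrite integral0_eq// => s _; rewrite /= HE (negPf tab) /= andbF.
  have [at_ tb] := andP tab.
  have ig' : mu.-integrable `[a, t] (EFin \o g).
    by apply: integrableS ig => //; apply: subset_itvl; rewrite bnd_simp.
  rewrite [in RHS](fg t tab) addrAC subrr add0r EFinM -integralE_Rintegral//.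
  rewrite -integralZl//.
  rewrite [RHS]integral_mkcond; apply: eq_integral => s _.
  rewrite /= HE patchE mem_setE in_itv/= tab /=.
  have [st|] := leP s t; last by rewrite !andbF.
  by rewrite (le_trans st tb)/= !andbT; case: ifP => // _; rewrite mulrC.
have := Fubini (kernel_integrable ig ipsi); rewrite [LHS]L [RHS]L' => -[] {L L'}.
rewrite (_ : (fun s => g s * (phi b - phi s)) =
       (fun s => phi b * g s + (- 1) * (g s * phi s))); last by apply/funext => s; ring.
rewrite (_ : (fun t => psi t * (f t - f a)) =
       (fun t => psi t * f t + (- f a) * psi t)); last by apply/funext => s; ring.
rewrite !RintegralD//; try exact: integrable_scaler.
rewrite !RintegralZl//.
have -> : \int[mu]_(t in `[a, b]) g t = f b - f a.
  by rewrite (fg b) ?ab ?lexx//; ring.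
have -> : \int[mu]_(t in `[a, b]) psi t = phi b - phi a.
  by rewrite (phipsi b) ?ab ?lexx//; ring.
under [X in _ = X + _ -> _ = _]eq_Rintegral do rewrite mulrC.
set X := Rintegral _ _ _; set Y := Rintegral _ _ _ => h.
have -> : X = phi b * (f b - f a) - (Y + - f a * (phi b - phi a)) by rewrite -h; ring.
by ring.
Qed.

End Primitive.

(** * Calculus of primitives and almost everywhere uniqueness of the derivative *)

Section SquareIntegrable.
Context {R : realType}.
Implicit Types (c t : R) (f g h phi psi : R -> R).
Notation mu := (@lebesgue_measure R).
Notation I := (@Ipi R).
Notation J := (@Ipi_int R).

Lemma primitive_on_derive (a b : R) phi psi : a <= b ->
  (forall t, is_derive t 1 phi (psi t)) -> continuous psi ->
  primitive_on a b phi psi.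
Proof.
move=> ab dphi cpsi.
have cphi : continuous phi.
  by move=> t; apply/differentiable_continuous/derivable1_diffP; have [] := dphi t.
split.
  apply: continuous_compact_integrable; first exact: segment_compact.
  exact: continuous_subspaceT.
(* The fundamental theorem of calculus is applied on a nondegenerate interval, so [t = a] is treated
   apart. *)
move=> t /andP[]; rewrite le_eqVlt => /predU1P[->|at_] tb.
  by rewrite set_itv1 Rintegral_set1 addr0.
rewrite /Rintegral (@continuous_FTC2 _ psi phi)//.
- by rewrite -EFinB /=; ring.
- exact: continuous_subspaceT.
- split; first by move=> x _; have [] := dphi x.
  + by apply: cvg_at_right_filter; exact: cphi.
  + by apply: cvg_at_left_filter; exact: cphi.
- by move=> x _; rewrite derive1E; have [_ ->] := dphi x.
Qed.

(** Integration by parts on each subinterval [[a, t]] is the primitive identity for the product at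
    [t]. *)
Lemma primitive_on_mul (a b : R) f g phi psi : a <= b ->
  primitive_on a b f g -> primitive_on a b phi psi ->
  primitive_on a b (fun t => f t * phi t) (fun t => g t * phi t + f t * psi t).
Proof.
move=> ab Pf Pphi; have [ig _] := Pf; have [ipsi _] := Pphi.
have cf := primitive_on_continuous ab Pf.
have cphi := primitive_on_continuous ab Pphi.
have ifpsi : mu.-integrable `[a, b] (EFin \o (fun t => f t * psi t)).
  have -> : (fun t => f t * psi t) = (fun t => psi t * f t).
    by apply/funext => t; rewrite mulrC.
  exact: integrable_mul_continuous.
have igphi := integrable_mul_continuous ig cphi.
split; first exact: integrable_addr.
move=> t /andP[at_ tb].
have sub : `[a, t] `<=` `[a, b] by apply: subset_itvl; rewrite bnd_simp.
have tab : a <= t <= b by rewrite at_.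
rewrite RintegralD//; [|exact: integrableS igphi|exact: integrableS ifpsi].
rewrite (primitive_on_by_parts at_ (primitive_on_sub tab Pf) (primitive_on_sub tab Pphi)).
by ring.
Qed.

Lemma primitive_on_add (a b : R) f g phi psi :
  primitive_on a b f g -> primitive_on a b phi psi ->
  primitive_on a b (fun t => f t + phi t) (fun t => g t + psi t).
Proof.
move=> [ig fg] [ipsi phipsi]; split; first exact: integrable_addr.
move=> t /andP[at_ tb].
have sub : `[a, t] `<=` `[a, b] by apply: subset_itvl; rewrite bnd_simp.
rewrite RintegralD//; [|exact: integrableS ig|exact: integrableS ipsi].
by rewrite fg ?at_// phipsi ?at_//; ring.
Qed.

Lemma primitive_on_scale (a b c : R) f g : primitive_on a b f g ->
  primitive_on a b (fun t => c * f t) (fun t => c * g t).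
Proof.
move=> [ig fg]; split; first exact: integrable_scaler.
move=> t /andP[at_ tb].
have sub : `[a, t] `<=` `[a, b] by apply: subset_itvl; rewrite bnd_simp.
rewrite RintegralZl//; last exact: integrableS ig.
by rewrite fg ?at_//; ring.
Qed.

(** Lebesgue differentiation: the indefinite integral of the zero extension of [g] is identically 0,
    and its derivative is almost everywhere that extension. *)
Lemma primitive_on0 (a b : R) f g : a <= b -> primitive_on a b f g ->
  (forall t, a <= t <= b -> f t = 0) -> ae_eq mu `[a, b]%classic (EFin \o g) (cst 0%E).
Proof.
move=> ab [ig fg] f0.
set g0 := g \_ `[a, b].
have ig0 : mu.-integrable setT (EFin \o g0).
  by rewrite -restrict_EFin; apply: (proj1 (integrable_mkcond _ _)).
have F0 (x : R) : \int[mu]_(t in `]-oo, x]) g0 t = 0.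
  rewrite /g0 -Rintegral_mkcondr.
  have [xa|ax] := ltP x a.
    rewrite (_ : _ `&` _ = set0) ?Rintegral_set0//.
    apply/seteqP; split => // t [] /=; rewrite !in_itv/= => tx /andP[at_ _].
    by have := le_lt_trans (le_trans at_ tx) xa; rewrite ltxx.
  (* The zero extension contributes nothing beyond [b], so the integral up to [x] stops at [y],
     where it equals [f y - f a]. *)
  pose y := Num.min x b.
  rewrite (_ : _ `&` _ = `[a, y]%classic); last first.
    apply/seteqP; split => t /=; rewrite !in_itv/= /y le_min.
      by move=> [-> /andP[-> ->]].
    by move=> /and3P[-> -> ->].
  have yab : a <= y <= b by rewrite /y le_min ax ab ge_min lexx orbT.
  have := fg _ yab; rewrite !f0 ?lexx//; lra.
have igy (y : R) : mu.-integrable `]-oo, y] (EFin \o g0).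
  by apply: integrableS ig0.
have /= := FTC1Ny igy (integrable_locally (measurable_itv _) ig).
have -> : (fun x => \int[mu]_(t in `]-oo, x]) g0 t) = cst 0.
  by apply/funext.
apply: filterS; first exact: (ae_filter_ringOfSetsType mu).
move=> x [_ e] xab /=.
move: e; rewrite derive1_cst /g0 patchE mem_set// => <-.
by [].
Qed.

End SquareIntegrable.

(** * Integrals over one period, square integrability and the periodic space H^1 *)

Section Periodic.
Context {R : realType}.
Implicit Types (c t : R) (f g h phi psi : R -> R).
Notation mu := (@lebesgue_measure R).
Notation I := (@Ipi R).
Notation J := (@Ipi_int R).

Definition integ f := mu.-integrable I (EFin \o f).

Lemma npi_le_pi : - pi <= pi :> R.
Proof. by have := @pi_ge0 R; lra. Qed.

Lemma in_Ipi t : I t <-> - pi <= t <= pi.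
Proof. by rewrite /Ipi /= in_itv. Qed.

Lemma eq_Ipi_int f g : (forall t, I t -> f t = g t) -> J f = J g.
Proof. by move=> fg; apply: eq_Rintegral => t /set_mem; exact: fg. Qed.

Lemma integ_ext f g : (forall t, I t -> f t = g t) -> integ f -> integ g.
Proof.
move=> fg; apply: eq_integrable; first exact: measurable_itv.
by move=> t /set_mem It /=; rewrite fg.
Qed.

Lemma integ_add f g : integ f -> integ g -> integ (fun t => f t + g t).
Proof. by move=> fi gi; apply: integrable_addr => //; exact: measurable_itv. Qed.

Lemma integ_scale c f : integ f -> integ (fun t => c * f t).
Proof. by move=> fi; apply: integrable_scaler => //; exact: measurable_itv. Qed.

Lemma Ipi_int_ge0 f : (forall t, I t -> 0 <= f t) -> 0 <= J f.
Proof. by move=> f0; apply: Rintegral_ge0. Qed.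

Implicit Type s : seq (R * (R -> R)).

(** Listing an integrand as pairs of a coefficient and a function lets a single use of
    [Ipi_int_lincomb] expand its integral. What remains is integrability of the listed functions and
    a pointwise algebraic identity. *)
Definition lincomb s t : R := foldr (fun p x => p.1 * p.2 t + x) 0 s.
Definition lincomb_int s : R := foldr (fun p x => p.1 * J p.2 + x) 0 s.
Definition all_integ s : Prop := foldr (fun p P => integ p.2 /\ P) True s.

Lemma Ipi_int_lincomb f s : all_integ s ->
  (forall t, I t -> f t = lincomb s t) -> J f = lincomb_int s.
Proof.
move=> si /eq_Ipi_int ->; suff: integ (lincomb s) /\ J (lincomb s) = lincomb_int s.
  by case.
elim: s si => [_|[c g] s IH /= [ig /IH [is_ <-]]] /=.
  split; last by rewrite /Ipi_int /Rintegral integral0_eq.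
  by apply: integrable0.
split; first by apply: integ_add => //; exact: integ_scale.
have mI : measurable (I : set (measurableTypeR R)) by exact: measurable_itv.
rewrite /Ipi_int -(RintegralZl c mI ig) -(RintegralD mI (integ_scale c ig) is_).
by [].
Qed.

(** The first conjunct supplies the measurability used for products. *)
Definition sqint f := integ f /\ integ (fun t => f t ^+ 2).

Lemma sqint_integ f : sqint f -> integ f. Proof. by case. Qed.

(** Dominated by [f ^+ 2 + g ^+ 2]. *)
Lemma integ_mul f g : sqint f -> sqint g -> integ (fun t => f t * g t).
Proof.
move=> [f1 f2] [g1 g2]; apply: le_integrable (integ_add f2 g2); first exact: measurable_itv.
  apply/measurable_EFinP; apply: measurable_funM; apply/measurable_EFinP.
  - exact: measurable_int f1.
  - exact: measurable_int g1.
move=> t _ /=; rewrite lee_fin normrM.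
apply: le_trans (ler_norm _); rewrite -(real_normK (num_real (f t))).
rewrite -(real_normK (num_real (g t))).
have := sqr_ge0 (`|f t| - `|g t|); have := sqr_ge0 (`|f t| + `|g t|).
by rewrite sqrrB sqrrD; lra.
Qed.

Lemma sqint_ext f g : (forall t, I t -> f t = g t) -> sqint f -> sqint g.
Proof.
move=> fg [f1 f2]; split; first exact: integ_ext f1.
by apply: integ_ext f2 => t It; rewrite fg.
Qed.

Lemma sqint_add f g : sqint f -> sqint g -> sqint (fun t => f t + g t).
Proof.
move=> hf hg; split; first by apply: integ_add; exact: sqint_integ.
have -> : (fun t => (f t + g t) ^+ 2) =
    (fun t => (f t ^+ 2 + g t ^+ 2) + 2 * (f t * g t)).
  by apply/funext => t; ring.
apply: integ_add; last by apply: integ_scale; exact: integ_mul.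
by apply: integ_add; [case: hf | case: hg].
Qed.

Lemma sqint_scale c f : sqint f -> sqint (fun t => c * f t).
Proof.
move=> [f1 f2]; split; first exact: integ_scale.
have -> : (fun t => (c * f t) ^+ 2) = (fun t => c ^+ 2 * f t ^+ 2).
  by apply/funext => t; ring.
exact: integ_scale.
Qed.

Lemma integ_within f : {within I, continuous f} -> integ f.
Proof. by apply: continuous_compact_integrable; exact: segment_compact. Qed.

Lemma within_mul f g : {within I, continuous f} -> {within I, continuous g} ->
  {within I, continuous (fun t => f t * g t)}.
Proof. by move=> cf cg t; apply: cvgM; [exact: cf|exact: cg]. Qed.

Lemma sqint_within f : {within I, continuous f} -> sqint f.
Proof.
move=> cf; split; apply: integ_within => //.
by apply: within_mul.
Qed.

Lemma sqint_continuous f : continuous f -> sqint f.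
Proof. by move=> cf; apply: sqint_within; exact: continuous_subspaceT. Qed.

Lemma sqint_mul_within f phi : sqint f -> {within I, continuous phi} ->
  sqint (fun t => f t * phi t).
Proof.
move=> [f1 f2] cphi; split; first exact: integrable_mul_continuous.
have -> : (fun t => (f t * phi t) ^+ 2) = (fun t => f t ^+ 2 * (phi t * phi t)).
  by apply/funext => t; ring.
by apply: integrable_mul_continuous => //; exact: within_mul.
Qed.

(** The degenerate case of Cauchy-Schwarz: the integral of [(r * g + h) ^+ 2] is then affine in [r],
    and an affine function that is nonnegative everywhere has slope zero. *)
Lemma Ipi_int_null_mul g h : sqint g -> sqint h -> J (fun t => g t ^+ 2) = 0 ->
  J (fun t => g t * h t) = 0.
Proof.
move=> Lg Lh g0.
set x := J (fun t => g t * h t); set y := J (fun t => h t ^+ 2).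
have quad (r : R) : 0 <= r * 2 * x + y.
  have -> : r * 2 * x + y = J (fun t => (r * g t + h t) ^+ 2).
    rewrite (@Ipi_int_lincomb _ [:: (r ^+ 2, fun t => g t ^+ 2);
      (r * 2, fun t => g t * h t); (1, fun t => h t ^+ 2)]) /=.
    - by rewrite g0 /x /y; ring.
    - by split; [case: Lg|split; [exact: integ_mul|split; [case: Lh|]]].
    - by move=> t _; ring.
  by apply: Ipi_int_ge0 => t _; exact: sqr_ge0.
have [//|x0] := eqVneq x 0.
(* At this [r] the affine function takes the value -1. *)
have := quad (- (y + 1) / (2 * x)).
have -> : - (y + 1) / (2 * x) * 2 * x = - (y + 1) by field.
lra.
Qed.

Lemma H1P f g : H1per_deriv f g <->
  [/\ primitive_on (- pi) pi f g, sqint g & f pi = f (- pi)].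
Proof.
split=> [[mg ig ig2 fg fp]|[[ig fg] [_ ig2] fp]].
  by split.
split => //.
by apply/measurable_EFinP; exact: measurable_int ig.
Qed.

Lemma H1_sqint_deriv f g : H1per_deriv f g -> sqint g.
Proof. by case/H1P. Qed.

Lemma H1_within f g : H1per_deriv f g -> {within I, continuous f}.
Proof. by case/H1P => P _ _; apply: primitive_on_continuous P; exact: npi_le_pi. Qed.

Lemma H1_sqint f g : H1per_deriv f g -> sqint f.
Proof. by move/H1_within; exact: sqint_within. Qed.

Lemma H1_add f g phi psi : H1per_deriv f g -> H1per_deriv phi psi ->
  H1per_deriv (fun t => f t + phi t) (fun t => g t + psi t).
Proof.
move=> /H1P[P1 L1 e1] /H1P[P2 L2 e2]; apply/H1P; split.
- exact: primitive_on_add.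
- exact: sqint_add.
- by rewrite e1 e2.
Qed.

Lemma H1_scale c f g : H1per_deriv f g ->
  H1per_deriv (fun t => c * f t) (fun t => c * g t).
Proof.
move=> /H1P[P1 L1 e1]; apply/H1P; split.
- exact: primitive_on_scale.
- exact: sqint_scale.
- by rewrite e1.
Qed.

Lemma H1_mul f g phi psi : H1per_deriv f g -> H1per_deriv phi psi ->
  H1per_deriv (fun t => f t * phi t) (fun t => g t * phi t + f t * psi t).
Proof.
move=> Hf Hphi; have cf := H1_within Hf; have cphi := H1_within Hphi.
move: Hf Hphi => /H1P[P1 L1 e1] /H1P[P2 L2 e2]; apply/H1P; split.
- exact: primitive_on_mul npi_le_pi P1 P2.
- apply: sqint_add; first exact: sqint_mul_within.
  have := sqint_mul_within L2 cf.
  by apply: sqint_ext => t _; rewrite mulrC.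
- by rewrite e1 e2.
Qed.

Lemma H1_by_parts f g phi psi : H1per_deriv f g -> H1per_deriv phi psi ->
  J (fun t => g t * phi t) = - J (fun t => f t * psi t).
Proof.
move=> /H1P[P1 L1 e1] /H1P[P2 L2 e2].
have := primitive_on_by_parts npi_le_pi P1 P2.
by rewrite -/(J _) -/(J _) e1 e2; lra.
Qed.

Lemma H1_int_deriv f g : H1per_deriv f g -> J g = 0.
Proof.
case/H1P => -[_ fg] _; rewrite (fg pi) ?npi_le_pi ?lexx//.
by rewrite -/(J g); lra.
Qed.

Lemma H1_derive phi psi : (forall t, is_derive t 1 phi (psi t)) ->
  continuous psi -> phi pi = phi (- pi) -> H1per_deriv phi psi.
Proof.
move=> d cpsi e; apply/H1P; split => //; last exact: sqint_continuous.
by apply: primitive_on_derive => //; exact: npi_le_pi.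
Qed.

Lemma H1_cst c : H1per_deriv (fun=> c) (fun=> 0).
Proof. by apply: H1_derive => // t; exact: cst_continuous. Qed.

Lemma H1_ext f1 g1 f2 g2 : (forall t, - pi <= t <= pi -> f1 t = f2 t) ->
  (forall t, g1 t = g2 t) -> H1per_deriv f1 g1 -> H1per_deriv f2 g2.
Proof.
move=> ff /funext <-; case=> mg ig ig2 fg fp; split => //.
  by move=> t tI; rewrite -!ff ?lexx ?npi_le_pi//; exact: fg.
by rewrite -!ff ?lexx ?npi_le_pi.
Qed.

(** A weak derivative is determined only almost everywhere, so its uniqueness is recorded as a
    vanishing L2 norm, the form in which it enters the integrals of the gap. *)
Lemma H1_zero_deriv f g : H1per_deriv f g -> (forall t, I t -> f t = 0) ->
  J (fun t => g t ^+ 2) = 0.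
Proof.
case/H1P => P [Lg1 Lg2] _ f0.
have g0 := primitive_on0 npi_le_pi P f0.
rewrite /Ipi_int /Rintegral (@ae_eq_integral _ _ _ mu I (cst 0%E)) //.
- by rewrite integral0.
- exact: measurable_itv.
- exact: (measurable_int mu Lg2).
- case: g0 => N [mN N0 subN]; exists N; split => // t /= h; apply: subN => h'.
  by apply: h => It; have [->] := h' It; rewrite expr0n.
Qed.

End Periodic.

(** * Trigonometric integrals over a period and an upper bound for pi *)

Section Trigonometric.
Context {R : realType}.
Implicit Types (a b c t : R) (f g h phi psi : R -> R) (m n : nat).
Notation mu := (@lebesgue_measure R).
Notation I := (@Ipi R).
Notation J := (@Ipi_int R).

Lemma is_derive_affine a b t : is_derive t 1 (fun s => a * s + b) a.
Proof.
have -> : (fun s => a * s + b) = (a *: id + cst b : R -> R) by apply/funext.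
by apply: is_derive_eq; rewrite /GRing.scale/= mulr1 addr0.
Qed.

Lemma is_derive_cos_affine a b t :
  is_derive t 1 (fun s => cos (a * s + b)) (- a * sin (a * t + b)).
Proof.
have d := is_derive_affine a b t.
have h : is_derive t 1 (cos \o (fun s => a * s + b)) (- sin (a * t + b) * a).
  exact: is_derive1_comp.
by rewrite mulNr mulrC -mulNr.
Qed.

Lemma is_derive_sin_affine a b t :
  is_derive t 1 (fun s => sin (a * s + b)) (a * cos (a * t + b)).
Proof.
have d := is_derive_affine a b t.
have h : is_derive t 1 (sin \o (fun s => a * s + b)) (cos (a * t + b) * a).
  exact: is_derive1_comp.
by rewrite mulrC.
Qed.

Lemma continuous_cos_affine a b : continuous (fun s : R => cos (a * s + b)).
Proof.
move=> t; apply/differentiable_continuous/derivable1_diffP.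
by have [] := is_derive_cos_affine a b t.
Qed.

Lemma continuous_sin_affine a b : continuous (fun s : R => sin (a * s + b)).
Proof.
move=> t; apply/differentiable_continuous/derivable1_diffP.
by have [] := is_derive_sin_affine a b t.
Qed.

Lemma sin_natpi n : sin (n%:R * pi : R) = 0.
Proof.
elim: n => [|n IH]; first by rewrite mul0r sin0.
by rewrite -natr1 mulrDl mul1r sinDpi IH oppr0.
Qed.

Lemma H1_cos n a :
  H1per_deriv (fun t => cos (n%:R * t + a)) (fun t => - n%:R * sin (n%:R * t + a)).
Proof.
apply: H1_derive.
- by move=> t; exact: is_derive_cos_affine.
- move=> t; apply: cvgM; first exact: cvg_cst.
  exact: continuous_sin_affine.
- by rewrite !cosD mulrN cosN sinN sin_natpi; ring.
Qed.

Lemma H1_sin n a :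
  H1per_deriv (fun t => sin (n%:R * t + a)) (fun t => n%:R * cos (n%:R * t + a)).
Proof.
apply: H1_derive.
- by move=> t; exact: is_derive_sin_affine.
- move=> t; apply: cvgM; first exact: cvg_cst.
  exact: continuous_cos_affine.
- by rewrite !sinD mulrN cosN sinN sin_natpi; ring.
Qed.

Lemma sqint_cos n a : sqint (fun t : R => cos (n%:R * t + a)).
Proof. by apply: sqint_continuous; exact: continuous_cos_affine. Qed.

Lemma sqint_sin n a : sqint (fun t : R => sin (n%:R * t + a)).
Proof. by apply: sqint_continuous; exact: continuous_sin_affine. Qed.

Lemma sqint_cst c : sqint (fun=> c : R).
Proof. by apply: sqint_continuous => t; exact: cst_continuous. Qed.

Lemma integ_cst c : integ (fun=> c : R).
Proof. exact/sqint_integ/sqint_cst. Qed.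

Lemma Ipi_int_cst c : J (fun=> c) = 2 * pi * c.
Proof.
rewrite /Ipi_int Rintegral_cst//; last exact: measurable_itv.
rewrite [fine _](_ : _ = 2 * pi) 1?mulrC//.
transitivity (fine (@lebesgue_measure R `[- pi, pi])); first by [].
rewrite lebesgue_measure_itv/= lte_fin ifT/=; first by ring.
by have := @pi_gt0 R; lra.
Qed.

(** Up to the nonzero factor [n], the integrand is the derivative of a periodic function. *)
Lemma Ipi_int_cos n a : (0 < n)%N -> J (fun t => cos (n%:R * t + a)) = 0.
Proof.
move=> n0; have := H1_int_deriv (H1_sin n a).
rewrite (@Ipi_int_lincomb _ _ [:: (n%:R, fun t => cos (n%:R * t + a))]) /=.
- have : n%:R != 0 :> R by rewrite pnatr_eq0 -lt0n.
  by move=> nn; rewrite addr0 => /eqP; rewrite mulf_eq0 (negPf nn) => /eqP.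
- by split => //; exact/sqint_integ/sqint_cos.
- by move=> t _; rewrite addr0.
Qed.

(** Product-to-sum formula; [0 < m < n] makes both frequencies [n + m] and [n - m] positive natural
    numbers. *)
Lemma Ipi_int_cos_cos_neq m n a b : (0 < m < n)%N ->
  J (fun t => cos (n%:R * t + a) * cos (m%:R * t + b)) = 0.
Proof.
move=> /andP[m0 mn].
rewrite (@Ipi_int_lincomb _ _
  [:: (1 / 2, fun t => cos ((n + m)%:R * t + (a + b)));
      (1 / 2, fun t => cos ((n - m)%:R * t + (a - b)))]) /=.
- by rewrite !Ipi_int_cos ?subn_gt0 ?addn_gt0 ?m0 ?orbT//; ring.
- by do 2![split; first exact/sqint_integ/sqint_cos].
- move=> t _; rewrite natrD natrB ?(ltnW mn)//.
  have -> : (n%:R + m%:R) * t + (a + b) = (n%:R * t + a) + (m%:R * t + b) by ring.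
  have -> : (n%:R - m%:R) * t + (a - b) = (n%:R * t + a) - (m%:R * t + b) by ring.
  by move: (n%:R * t + a) (m%:R * t + b) => x y; rewrite cosB cosD; field.
Qed.

Lemma Ipi_int_cos_cos n a b : (0 < n)%N ->
  J (fun t => cos (n%:R * t + a) * cos (n%:R * t + b)) = pi * cos (a - b).
Proof.
move=> n0; rewrite (@Ipi_int_lincomb _ _
  [:: (1 / 2, fun t => cos ((n + n)%:R * t + (a + b)));
      (1 / 2, fun=> cos (a - b))]) /=.
- by rewrite Ipi_int_cos ?addn_gt0 ?n0// Ipi_int_cst; field.
- split; first exact/sqint_integ/sqint_cos.
  by split => //; exact: integ_cst.
- move=> t _; rewrite natrD.
  have -> : (n%:R + n%:R) * t + (a + b) = (n%:R * t + a) + (n%:R * t + b) by ring.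
  have -> : a - b = (n%:R * t + a) - (n%:R * t + b) by ring.
  by move: (n%:R * t + a) (n%:R * t + b) => x y; rewrite cosB cosD; field.
Qed.

Lemma sin_phase a : sin a = cos (a - pi / 2) :> R.
Proof. by rewrite cosBpihalf. Qed.

(** Drives the chain of Taylor bounds below: [cos <= 1] gives [sin_le_id], then [cos_ge_taylor],
    then [sin_ge_taylor], each by integrating the previous one from 0. *)
Lemma derive_ge0_le phi psi (x : R) : 0 <= x ->
  (forall t, is_derive t 1 phi (psi t)) -> continuous psi ->
  (forall t, 0 <= t -> 0 <= psi t) -> phi 0 <= phi x.
Proof.
move=> x0 d cpsi psi0; have [_ /(_ x)] := primitive_on_derive x0 d cpsi.
rewrite x0 lexx => ->//; rewrite lerDl; apply: Rintegral_ge0 => t /=.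
by rewrite in_itv/= => /andP[/psi0].
Qed.

Lemma is_derive_sqr_half t : is_derive t 1 (fun s : R => s ^+ 2 / 2) t.
Proof.
have -> : (fun s : R => s ^+ 2 / 2) = ((2^-1 : R) *: (id ^+ 2) : R -> R).
  by apply/funext => s; rewrite mulrC.
by apply: is_derive_eq; rewrite /GRing.scale/= expr1 mulr1; field.
Qed.

Lemma is_derive_cube_third t : is_derive t 1 (fun s : R => s ^+ 3 / 3) (t ^+ 2).
Proof.
have -> : (fun s : R => s ^+ 3 / 3) = ((3^-1 : R) *: (id ^+ 3) : R -> R).
  by apply/funext => s; rewrite mulrC.
by apply: is_derive_eq; rewrite /GRing.scale/= mulr1; field.
Qed.

Lemma sin_le_id t : 0 <= t -> sin t <= t.
Proof.
move=> t0; have h := @derive_ge0_le (fun s => s - sin s) (fun s => 1 - cos s) t t0.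
suff : 0 - sin 0 <= t - sin t by rewrite sin0; lra.
apply: h.
- by move=> s; apply: cvgB; [exact: cvg_cst|exact: continuous_cos].
- by move=> s _; rewrite subr_ge0 cos_le1.
Qed.

Lemma cos_ge_taylor t : 0 <= t -> 1 - t ^+ 2 / 2 <= cos t.
Proof.
move=> t0; have := @derive_ge0_le (fun s => cos s + s ^+ 2 / 2)
  (fun s => - sin s + s) t t0.
move=> h.
suff : cos 0 + 0 ^+ 2 / 2 <= cos t + t ^+ 2 / 2 by rewrite cos0; lra.
apply: h.
- by move=> s; have d := is_deriveD (is_derive_cos s) (is_derive_sqr_half s); exact d.
- by move=> s; apply: cvgD; [apply: cvgN; exact: continuous_sin|exact: cvg_id].
- by move=> s /sin_le_id; lra.
Qed.

Lemma sin_ge_taylor t : 0 <= t -> t - t ^+ 3 / 6 <= sin t.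
Proof.
move=> t0; have := @derive_ge0_le (fun s => (sin s - s) + 2^-1 *: (s ^+ 3 / 3))
  (fun s => (cos s - 1) + 2^-1 *: s ^+ 2) t t0.
move=> h.
suff : (sin 0 - 0) + 2^-1 *: (0 ^+ 3 / 3) <= sin t - t + 2^-1 *: (t ^+ 3 / 3).
  by rewrite sin0 /GRing.scale/=; lra.
apply: h.
- move=> s; have d := is_deriveD (is_deriveB (is_derive_sin s) (is_derive_id s 1))
    (is_deriveZ 2^-1 (is_derive_cube_third s)).
  exact d.
- move=> s; apply: cvgD.
    by apply: cvgB; [exact: continuous_cos|exact: cvg_cst].
  by apply: cvgM; [exact: cvg_cst|exact: exprn_continuous].
- by move=> s /cos_ge_taylor; rewrite /GRing.scale/=; lra.
Qed.

(* [sin (pi / 4) ^+ 2 = 1 / 2], whereas [0.81 - 0.81 ^+ 3 / 6 > 0.72]. *)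
Lemma pi_lt_324 : pi < 81 / 25 :> R.
Proof.
rewrite ltNge; apply/negP => hpi.
have h4 : (pi / 4 : R) + pi / 4 = pi / 2 by field.
have := @sin_pihalf R; have := @cos_pihalf R; rewrite -h4 sinD cosD.
have := cos2Dsin2 (pi / 4 : R).
set s := sin (pi / 4); set c := cos (pi / 4) => e1 e2 e3.
have s2 : s ^+ 2 = 1 / 2 by rewrite !expr2 in e1 *; lra.
have : sin (81 / 100) <= s.
  have := @pi_ge2 R => pi2.
  rewrite leNgt /s ltr_sin -?leNgt ?in_itv/=; lra.
have : 72 / 100 <= sin (81 / 100 : R).
  by apply: le_trans (@sin_ge_taylor (81 / 100) _); lra.
by nra.
Qed.

End Trigonometric.

(** * The periodic Wirtinger inequality with its equality case *)

Section Wirtinger.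
Context {R : realType}.
Implicit Types (a b c t : R) (f g h phi psi rho : R -> R) (m n : nat).
Notation mu := (@lebesgue_measure R).
Notation I := (@Ipi R).
Notation J := (@Ipi_int R).

(** A real-valued indicator, so that an integral over [[- pi, t]] becomes an integral over the full
    period and fits into the expansions by [Ipi_int_lincomb]. *)
Definition before t (s : R) : R := (s <= t)%R%:R.

Lemma before_restrict t f : (fun s => before t s * f s) = f \_ `]-oo, t].
Proof.
apply/funext => s; rewrite patchE mem_setE in_itv/= /before.
by case: ifP; rewrite ?mul1r ?mul0r.
Qed.

Lemma Ipi_before t : I t -> I `&` `]-oo, t] = `[- pi, t]%classic.
Proof.
move/in_Ipi => /andP[_ tpi]; apply/seteqP; split => s /=; rewrite !in_itv/=.
  by move=> [/in_Ipi/andP[-> _] ->].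
by move=> /andP[s0 st]; split => //; apply/in_Ipi; rewrite s0 (le_trans st tpi).
Qed.

Lemma integ_before t f : I t -> integ f -> integ (fun s => before t s * f s).
Proof.
move=> It ig; rewrite before_restrict /integ -restrict_EFin.
apply/integrable_restrict; [exact: measurable_itv|exact: measurable_itv|].
by apply: integrableS ig; [exact: measurable_itv|
  rewrite Ipi_before//; exact: measurable_itv|exact: subIsetl].
Qed.

Lemma Ipi_int_before t f g : I t -> primitive_on (- pi) pi f g ->
  J (fun s => before t s * g s) = f t - f (- pi).
Proof.
move=> It [ig fg]; rewrite before_restrict /Ipi_int -Rintegral_mkcondr Ipi_before//.
by move/in_Ipi: It => It; rewrite (fg t It); ring.
Qed.

Lemma before_sqr t (s : R) : before t s * before t s = before t s.
Proof. by rewrite /before; case: (s <= t); rewrite ?mulr1 ?mulr0. Qed.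

Lemma sqint_before t : I t -> sqint (before t).
Proof.
move=> It; have h := integ_before It (@integ_cst R 1).
split; apply: integ_ext h => s _; first by rewrite mulr1.
by rewrite expr2 before_sqr mulr1.
Qed.

Lemma primitive_id : primitive_on (- pi) pi id (fun=> 1 : R).
Proof.
apply: primitive_on_derive; first exact: npi_le_pi.
by move=> t; exact: cvg_cst.
Qed.

Lemma primitive_sqr : primitive_on (- pi) pi (fun s : R => s ^+ 2 / 2) id.
Proof.
apply: primitive_on_derive; first exact: npi_le_pi.
  exact: is_derive_sqr_half.
by move=> t; exact: cvg_id.
Qed.

Lemma primitive_cube : primitive_on (- pi) pi (fun s : R => s ^+ 3 / 3) (fun s => s ^+ 2).
Proof.
apply: primitive_on_derive; first exact: npi_le_pi.
  exact: is_derive_cube_third.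
exact: exprn_continuous.
Qed.

Lemma primitive_int f g : primitive_on (- pi) pi f g -> J g = f pi - f (- pi).
Proof.
by move=> [_ fg]; rewrite (fg pi) ?npi_le_pi ?lexx//; rewrite -/(J g); ring.
Qed.

(* As a function of [s], a 2 pi-periodic sawtooth jumping at [t]. *)
Definition sawtooth t (s : R) : R := s - t - pi + 2 * pi * before t s.

Lemma sqint_affine a : sqint (fun s : R => s + a).
Proof.
by apply: sqint_continuous => t; apply: cvgD; [exact: cvg_id|exact: cvg_cst].
Qed.

Lemma sqint_sawtooth t : I t -> sqint (sawtooth t).
Proof.
move=> It; apply: sqint_add; last by apply: sqint_scale; exact: sqint_before.
by apply: sqint_ext (sqint_affine (- t - pi)) => s _; ring.
Qed.

(** The linear part of the sawtooth is integrated by parts against [g], and its jump contributes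
    [2 * pi * (f t - f (- pi))]. By periodicity the boundary term is [2 * pi * f (- pi)], which
    cancels, so that pairing with the derivative evaluates [f] at [t]. *)
Lemma sawtooth_represents t f g : I t -> H1per_deriv f g ->
  J (fun s => sawtooth t s * g s) = 2 * pi * f t - J f.
Proof.
move=> It Hf; have Lg := H1_sqint_deriv Hf; have Lf := H1_sqint Hf.
have [P _ e] := (H1P f g).1 Hf.
have ibp := primitive_on_by_parts npi_le_pi P primitive_id.
have gid : integ (fun s => g s * s).
  by apply: integ_mul => //; apply: sqint_ext (sqint_affine 0) => s _; rewrite addr0.
rewrite (@Ipi_int_lincomb _ _ [:: (1, fun s => g s * s); (- t - pi, g);
   (2 * pi, fun s => before t s * g s)]) /=.
- rewrite (H1_int_deriv Hf) (Ipi_int_before It P).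
  have -> : J (fun s => g s * s) = 2 * pi * f (- pi) - J f.
    rewrite (@Ipi_int_lincomb _ f [:: (1, fun s => f s * 1)]) /=.
    + by rewrite /Ipi_int; move: ibp; rewrite e; lra.
    + by split => //; apply: integ_ext (sqint_integ Lf) => s _; rewrite mulr1.
    + by move=> s _; ring.
  by ring.
- split; first exact: gid.
  split; first by case: Lg.
  by split => //; apply: integ_before => //; case: Lg.
- by move=> s _; rewrite /sawtooth; ring.
Qed.

(** By periodicity in [s] the value does not depend on [t]: it is the integral of [s ^+ 2] over one
    period. *)
Lemma sawtooth_norm t : I t -> J (fun s => sawtooth t s ^+ 2) = 2 / 3 * pi ^+ 3.
Proof.
move=> It; have Lid : sqint (id : R -> R).
  by apply: sqint_ext (sqint_affine 0) => s _; rewrite addr0.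
have Isq : integ (fun s : R => s ^+ 2) by case: Lid.
rewrite (@Ipi_int_lincomb _ _ [:: (1, fun s => s ^+ 2); (- 2 * (t + pi), id);
   ((t + pi) ^+ 2, fun=> 1); (4 * pi, fun s => before t s * s);
   (- 4 * pi * (t + pi) + 4 * pi ^+ 2, fun s => before t s * 1)]) /=.
- rewrite (primitive_int primitive_cube) (primitive_int primitive_sqr).
  rewrite (primitive_int primitive_id).
  by rewrite (Ipi_int_before It primitive_sqr) (Ipi_int_before It primitive_id); field.
- split; first exact: Isq.
  split; first by case: Lid.
  split; first exact: integ_cst.
  split; first by apply: integ_before => //; case: Lid.
  by split => //; apply: integ_before => //; exact: integ_cst.
- move=> s _; rewrite /sawtooth.
  have -> : (s - t - pi + 2 * pi * before t s) ^+ 2 =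
    (s - t - pi) ^+ 2 + 4 * pi * (s - t - pi) * before t s
    + 4 * pi ^+ 2 * (before t s * before t s) by ring.
  by rewrite before_sqr; ring.
Qed.

(** Fourier coefficients without the factor [1 / pi]. The sine is written as a shifted cosine so
    that the integrals of products of cosines cover every pairing of modes. *)
Definition fcos n f : R := J (fun s => f s * cos (n%:R * s + 0)).
Definition fsin n f : R := J (fun s => f s * cos (n%:R * s + - (pi / 2))).

Lemma cos_quarter n a (s : R) :
  cos (n%:R * s + (a - pi / 2)) = sin (n%:R * s + a).
Proof. by rewrite addrA cosBpihalf. Qed.

Lemma cos_phase n a (s : R) : cos (n%:R * s + a) =
  cos a * cos (n%:R * s + 0) - sin a * cos (n%:R * s + - (pi / 2)).
Proof. by rewrite cosBpihalf addr0 cosD; ring. Qed.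

Lemma Ipi_int_mul_cos n a f : sqint f ->
  J (fun s => f s * cos (n%:R * s + a)) = cos a * fcos n f - sin a * fsin n f.
Proof.
move=> Lf; rewrite (@Ipi_int_lincomb _ _
  [:: (cos a, fun s => f s * cos (n%:R * s + 0));
      (- sin a, fun s => f s * cos (n%:R * s + - (pi / 2)))]) /=.
- by rewrite /fcos /fsin; ring.
- by split; [|split => //]; apply: integ_mul => //; exact: sqint_cos.
- by move=> s _; rewrite cos_phase; ring.
Qed.

(* The first two Fourier modes are subtracted off the sawtooth; this brings
   [J (K ^+ 2)] below [2 * pi]. *)
Lemma high_frequency_bound rho drho t : I t -> H1per_deriv rho drho ->
  J rho = 0 -> fcos 1 rho = 0 -> fsin 1 rho = 0 -> fcos 2 rho = 0 ->
  fsin 2 rho = 0 ->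
  (9 * pi - 2 / 3 * pi ^+ 3) * rho t ^+ 2 <= J (fun s => drho s ^+ 2).
Proof.
move=> It H r0 c1 s1 c2 s2.
have Lr := H1_sqint H; have Ld := H1_sqint_deriv H.
(* With these phases [S s = 2 * sin (s - t) + sin (2 * (s - t))], which is minus the first two
   Fourier modes of [sawtooth t]; [P] is its periodic primitive. *)
pose a1 := - t - pi / 2; pose a2 := - (2 * t) - pi / 2.
pose S s := 2 * cos (1%:R * s + a1) + cos (2%:R * s + a2).
pose P s := 2 * sin (1%:R * s + a1) + 2^-1 * sin (2%:R * s + a2).
have HP : H1per_deriv P S.
  have := H1_add (H1_scale 2 (H1_sin 1 a1)) (H1_scale 2^-1 (H1_sin 2 a2)).
  by apply: H1_ext => // s; rewrite /S mul1r mulrA mulVf ?mul1r// pnatr_eq0.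
have LS := H1_sqint_deriv HP.
(* After integration by parts [rho] meets the derivative of [S], again a combination of modes 1 and
   2, to which it is orthogonal. *)
have JdS : J (fun s => drho s * S s) = 0.
  have HS := H1_add (H1_scale 2 (H1_cos 1 a1)) (H1_cos 2 a2).
  rewrite (H1_by_parts H HS).
  rewrite (@Ipi_int_lincomb _ _
    [:: (- 2, fun s => rho s * cos (1%:R * s + (a1 - pi / 2)));
        (- 2, fun s => rho s * cos (2%:R * s + (a2 - pi / 2)))]) /=.
  - by rewrite !Ipi_int_mul_cos// c1 s1 c2 s2; ring.
  - by split; [|split => //]; apply: integ_mul => //; exact: sqint_cos.
  - by move=> s _; rewrite (cos_quarter 1) (cos_quarter 2); ring.
have JSS : J (fun s => S s ^+ 2) = 5 * pi.
  rewrite (@Ipi_int_lincomb _ _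
  [:: (4, fun s => cos (1%:R * s + a1) * cos (1%:R * s + a1));
      (4, fun s => cos (2%:R * s + a2) * cos (1%:R * s + a1));
      (1, fun s => cos (2%:R * s + a2) * cos (2%:R * s + a2))]) /=.
  - by rewrite !Ipi_int_cos_cos// Ipi_int_cos_cos_neq// !subrr cos0; ring.
  - by split; [|split; [|split => //]]; apply: integ_mul; exact: sqint_cos.
  - by move=> s _; rewrite /S; ring.
have JP : J P = 0.
  rewrite (@Ipi_int_lincomb _ _
    [:: (2, fun s => cos (1%:R * s + (a1 - pi / 2)));
        (2^-1, fun s => cos (2%:R * s + (a2 - pi / 2)))]) /=.
  - by rewrite !Ipi_int_cos//; ring.
  - by split; [|split => //]; exact/sqint_integ/sqint_cos.
  - by move=> s _; rewrite (cos_quarter 1) (cos_quarter 2) /P; ring.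
have LK := sqint_sawtooth It.
(* The representation formula for [P] gives [2 * pi * P t], and [P t = - 2 - 1 / 2]. *)
have JKS : J (fun s => sawtooth t s * S s) = - 5 * pi.
  rewrite (sawtooth_represents It HP) JP /P.
  have -> : 1%:R * t + a1 = - (pi / 2) by rewrite /a1; ring.
  have -> : 2%:R * t + a2 = - (pi / 2) by rewrite /a2; ring.
  by rewrite sinN sin_pihalf; field.
have JKd : J (fun s => sawtooth t s * drho s) = 2 * pi * rho t.
  by rewrite (sawtooth_represents It H) r0 subr0.
have JKK := sawtooth_norm It.
have : 0 <= J (fun s => (drho s - rho t * (sawtooth t s + S s)) ^+ 2).
  by apply: Ipi_int_ge0 => s _; exact: sqr_ge0.
rewrite (@Ipi_int_lincomb _ _
  [:: (1, fun s => drho s ^+ 2);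
      (- 2 * rho t, fun s => sawtooth t s * drho s);
      (- 2 * rho t, fun s => drho s * S s);
      (rho t ^+ 2, fun s => sawtooth t s ^+ 2);
      (2 * rho t ^+ 2, fun s => sawtooth t s * S s);
      (rho t ^+ 2, fun s => S s ^+ 2)]) /=.
- by rewrite JKd JdS JKK JKS JSS; lra.
- split; first by case: Ld.
  split; first exact: integ_mul.
  split; first exact: integ_mul.
  split; first by case: LK.
  split; first exact: integ_mul.
  by split => //; case: LS.
- by move=> s _; ring.
Qed.

(** Orthogonal projection onto the complement of frequency [n]: Pythagoras holds for [f] and for its
    derivative, where the mode has weight [n ^ 2]. Preserving the mean and the lower modes allows
    modes 1 and 2 to be removed in succession. *)
Lemma remove_mode n f g : (0 < n)%N -> H1per_deriv f g ->
  exists c s fh gh, [/\ H1per_deriv fh gh,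
    (forall t, f t = fh t + (c * cos (n%:R * t) + s * sin (n%:R * t))),
    J (fun t => f t ^+ 2) = J (fun t => fh t ^+ 2) + pi * (c ^+ 2 + s ^+ 2),
    J (fun t => g t ^+ 2) =
      J (fun t => gh t ^+ 2) + n%:R ^+ 2 * pi * (c ^+ 2 + s ^+ 2) &
    [/\ J fh = J f, fcos n fh = 0, fsin n fh = 0 &
      forall m, (0 < m < n)%N -> fcos m fh = fcos m f /\ fsin m fh = fsin m f]].
Proof.
move=> n0 H; have Lf := H1_sqint H; have Lg := H1_sqint_deriv H.
have pi0 : pi != 0 :> R by rewrite gt_eqF// pi_gt0.
pose c := fcos n f / pi; pose s := fsin n f / pi.
have ec : fcos n f = pi * c by rewrite /c mulrC divfK.
have es : fsin n f = pi * s by rewrite /s mulrC divfK.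
pose C t : R := cos (n%:R * t + 0); pose S t : R := cos (n%:R * t + - (pi / 2)).
pose dC t : R := sin (n%:R * t + 0); pose dS t : R := sin (n%:R * t + - (pi / 2)).
have LC : sqint C by exact: sqint_cos.
have LS : sqint S by exact: sqint_cos.
have LdC : sqint dC by exact: sqint_sin.
have LdS : sqint dS by exact: sqint_sin.
have CC : J (fun t => C t * C t) = pi.
  by rewrite /C Ipi_int_cos_cos// subrr cos0 mulr1.
have SS : J (fun t => S t * S t) = pi.
  by rewrite /S Ipi_int_cos_cos// subrr cos0 mulr1.
have CS : J (fun t => C t * S t) = 0.
  by rewrite /C /S Ipi_int_cos_cos// sub0r opprK cos_pihalf mulr0.
have SC : J (fun t => S t * C t) = 0.
  by rewrite -CS; apply: eq_Ipi_int => t _; rewrite mulrC.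
(* Differentiation only exchanges the two modes of frequency [n] up to sign and the factor [n], so
   the same inner products serve for the derivative. *)
have dCE t : dC t = S t by rewrite /dC /S sin_phase addr0.
have dSE t : dS t = - C t by rewrite /dS /C sinBpihalf addr0.
have gdC : J (fun t => g t * dC t) = - n%:R * pi * c.
  rewrite (H1_by_parts H (H1_sin n 0)).
  rewrite (@Ipi_int_lincomb _ _ [:: (n%:R, fun t => f t * C t)]) /=.
  - by rewrite -/(fcos n f) ec; ring.
  - by split => //; exact: integ_mul.
  - by move=> t _; rewrite /C; ring.
have gdS : J (fun t => g t * dS t) = - n%:R * pi * s.
  rewrite (H1_by_parts H (H1_sin n (- (pi / 2)))).
  rewrite (@Ipi_int_lincomb _ _ [:: (n%:R, fun t => f t * S t)]) /=.
  - by rewrite -/(fsin n f) es; ring.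
  - by split => //; exact: integ_mul.
  - by move=> t _; rewrite /S; ring.
pose fh t := f t + ((- c) * C t + (- s) * S t).
pose gh t := g t + ((- c) * (- n%:R * dC t) + (- s) * (- n%:R * dS t)).
have Hh : H1per_deriv fh gh.
  exact: H1_add H (H1_add (H1_scale (- c) (H1_cos n 0)) (H1_scale (- s) (H1_cos n _))).
have Lh := H1_sqint Hh.
have Jh phi : sqint phi -> J (fun t => fh t * phi t) = J (fun t => f t * phi t)
    - c * J (fun t => C t * phi t) - s * J (fun t => S t * phi t).
  move=> Lphi; rewrite (@Ipi_int_lincomb _ _ [:: (1, fun t => f t * phi t);
    (- c, fun t => C t * phi t); (- s, fun t => S t * phi t)]) /=.
  - by ring.
  - by split; [|split; [|split => //]]; exact: integ_mul.
  - by move=> t _; rewrite /fh; ring.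
exists c, s, fh, gh; split.
- exact: Hh.
- by move=> t; rewrite /fh /C /S cosBpihalf addr0; ring.
- rewrite [in RHS](@Ipi_int_lincomb _ _ [:: (1, fun t => f t ^+ 2);
    (- 2 * c, fun t => f t * C t); (- 2 * s, fun t => f t * S t);
    (c ^+ 2, fun t => C t * C t); (s ^+ 2, fun t => S t * S t);
    (2 * c * s, fun t => C t * S t)]) /=.
  + by rewrite -/(fcos n f) -/(fsin n f) ec es CC SS CS; ring.
  + split; first by case: Lf.
    by do 4![split; first exact: integ_mul]; split => //; exact: integ_mul.
  + by move=> t _; rewrite /fh; ring.
- rewrite [in RHS](@Ipi_int_lincomb _ _ [:: (1, fun t => g t ^+ 2);
    (2 * n%:R * c, fun t => g t * dC t); (2 * n%:R * s, fun t => g t * dS t);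
    (n%:R ^+ 2 * c ^+ 2, fun t => S t * S t);
    (n%:R ^+ 2 * s ^+ 2, fun t => C t * C t);
    (- 2 * n%:R ^+ 2 * c * s, fun t => C t * S t)]) /=.
  + by rewrite gdC gdS CC SS CS; ring.
  + split; first by case: Lg.
    by do 4![split; first exact: integ_mul]; split => //; exact: integ_mul.
  + by move=> t _; rewrite /gh dCE dSE; ring.
- split.
  + have := Jh (fun=> 1) (sqint_cst 1).
    have e phi : J (fun t => phi t * 1) = J phi.
      by apply: eq_Ipi_int => t _; rewrite mulr1.
    by rewrite !e /C /S !Ipi_int_cos// => ->; ring.
  + by rewrite /fcos Jh// -/(fcos n f) ec CC SC; ring.
  + by rewrite /fsin Jh// -/(fsin n f) es SS CS; ring.
  + move=> m mn; split.
      by rewrite /fcos Jh ?Ipi_int_cos_cos_neq//; [ring|exact: sqint_cos].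
    by rewrite /fsin Jh ?Ipi_int_cos_cos_neq//; [ring|exact: sqint_cos].
Qed.

(** Mode 1 contributes equally to both sides, mode 2 four times as much to the right, and the
    remainder [rho] has a strictly better constant. Equality therefore kills mode 2 and [rho]. *)
Lemma wirtinger f g : H1per_deriv f g -> J f = 0 ->
  J (fun t => f t ^+ 2) <= J (fun t => g t ^+ 2) /\
  (J (fun t => f t ^+ 2) = J (fun t => g t ^+ 2) ->
   exists a b, forall t, I t -> f t = a * cos t + b * sin t).
Proof.
move=> H f0.
have [a [b [f1 [g1 [H1 e1 n1 d1 [m1 c1 s1 _]]]]]] := remove_mode (isT : 0 < 1)%N H.
have [p [q [rho [drho [H2 e2 n2 d2 [m2 c2 s2 r2]]]]]] :=
  remove_mode (isT : 0 < 2)%N H1.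
have [r2c r2s] := r2 1%N isT.
have bound t : I t -> (9 * pi - 2 / 3 * pi ^+ 3) * rho t ^+ 2
    <= J (fun s => drho s ^+ 2).
  move=> It; apply: high_frequency_bound => //.
  - by rewrite m2 m1.
  - by rewrite r2c.
  - by rewrite r2s.
set E := J (fun s => drho s ^+ 2) in bound d2.
set N := J (fun s => rho s ^+ 2) in n2.
have N0 : 0 <= N by apply: Ipi_int_ge0 => t _; exact: sqr_ge0.
set k := 9 * pi - 2 / 3 * pi ^+ 3 in bound.
(* The pointwise bound is integrated over an interval of length [2 * pi]. *)
have ibound : k * N <= 2 * pi * E.
  have : 0 <= J (fun t => E - k * rho t ^+ 2).
    by apply: Ipi_int_ge0 => t It; rewrite subr_ge0; exact: bound.
  rewrite (@Ipi_int_lincomb _ _ [:: (1, fun=> E); (- k, fun t => rho t ^+ 2)]) /=.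
  - by rewrite Ipi_int_cst -/N; lra.
  - split; first exact: integ_cst.
    by split => //; have [] := H1_sqint H2.
  - by move=> t _; ring.
have pi0 := @pi_gt0 R.
have kpi : 2 * pi < k.
  (* This suffices because [k - 2 * pi = 2 / 3 * pi * (21 / 2 - pi ^ 2)]; the bound [81 / 25] on pi
     squares to 10.4976. *)
  have pi2 : pi ^+ 2 < 21 / 2 :> R by have := @pi_lt_324 R; nra.
  have : 0 < pi * (21 / 2 - pi ^+ 2) :> R by rewrite mulr_gt0// subr_gt0.
  by rewrite /k; lra.
have NE : N <= E by nra.
have pq : 0 <= pi * (p ^+ 2 + q ^+ 2).
  apply: mulr_ge0; [exact: ltW|exact: addr_ge0 (sqr_ge0 _) (sqr_ge0 _)].
rewrite n1 n2 d1 d2; split; first lra.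
move=> e.
have EN : E = N by lra.
have pq0 : pi * (p ^+ 2 + q ^+ 2) = 0 by lra.
(* Now [k * N <= 2 * pi * N] with [2 * pi < k], so [N] cannot be positive; the pointwise bound then
   makes [rho] vanish everywhere on the period. *)
have E0 : E <= 0 by rewrite EN in ibound *; nra.
have [p0 q0] : p = 0 /\ q = 0.
  move/eqP: pq0; rewrite mulf_eq0 gt_eqF//= paddr_eq0 ?sqr_ge0// !sqrf_eq0.
  by move=> /andP[/eqP-> /eqP->].
exists a, b => t It; rewrite e1 e2 p0 q0 !mul1r.
have : rho t ^+ 2 = 0.
  apply/eqP; rewrite eq_le sqr_ge0 andbT.
  have := bound t It; have := sqr_ge0 (rho t); nra.
by move=> /eqP; rewrite sqrf_eq0 => /eqP ->; ring.
Qed.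

End Wirtinger.

(** * The energy gap in the moving frame *)

Section Frame.
Context {R : realType}.
Implicit Types (t theta r : R) (f g h : R -> R).
Notation mu := (@lebesgue_measure R).
Notation I := (@Ipi R).
Notation J := (@Ipi_int R).

Definition mean f : R := J f / (2 * pi).

Lemma Ipi_int_mean f : J f = 2 * pi * mean f.
Proof.
by rewrite /mean mulrC divfK// mulf_neq0 ?pnatr_eq0// gt_eqF// pi_gt0.
Qed.

(** The sawtooth pairing with [g] vanishes, so the representation formula leaves only the mean, at
    every point and not merely almost everywhere. *)
Lemma H1_null_deriv f g : H1per_deriv f g -> J (fun t => g t ^+ 2) = 0 ->
  forall t, I t -> f t = mean f.
Proof.
move=> H g0 t It; have := sawtooth_represents It H.
have -> : J (fun s => sawtooth t s * g s) = 0.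
  rewrite -(Ipi_int_null_mul (H1_sqint_deriv H) (sqint_sawtooth It) g0).
  by apply: eq_Ipi_int => s _; rewrite mulrC.
have pi0 := @pi_gt0 R.
rewrite Ipi_int_mean => /esym/eqP; rewrite -mulrBr mulf_eq0 subr_eq0.
by rewrite gt_eqF ?mulr_gt0//= => /eqP.
Qed.

Lemma H1_center f g : H1per_deriv f g -> H1per_deriv (fun t => f t - mean f) g.
Proof.
move=> H; have := H1_add H (H1_cst (- mean f)).
by apply: H1_ext => // t; rewrite addr0.
Qed.

Lemma Ipi_int_center f : integ f -> J (fun t => f t - mean f) = 0.
Proof.
move=> If; rewrite (@Ipi_int_lincomb _ _ [:: (1, f); (1, fun=> - mean f)]) /=.
- by rewrite Ipi_int_mean Ipi_int_cst; ring.
- by split => //; split => //; exact: integ_cst.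
- by move=> t _; ring.
Qed.

(** The minus sign is chosen so that [x * cos t + y * sin t = r * cos (theta + t)]. *)
Lemma polar_form (x y : R) : exists r theta,
  [/\ 0 <= r, - pi <= theta <= pi, x = r * cos theta & y = - (r * sin theta)].
Proof.
pose r := Num.sqrt (x ^+ 2 + y ^+ 2).
have r2 : r ^+ 2 = x ^+ 2 + y ^+ 2 by rewrite sqr_sqrtr// addr_ge0 ?sqr_ge0.
have r_ge0 : 0 <= r by exact: sqrtr_ge0.
have [r0|rN0] := eqVneq r 0.
  exists 0, 0; have := @pi_ge0 R => pi0.
  move/esym/eqP: r2; rewrite r0 expr0n/= paddr_eq0 ?sqr_ge0// !sqrf_eq0.
  by move=> /andP[/eqP-> /eqP->]; split; rewrite ?mul0r ?oppr0//; lra.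
have xr : -1 <= x / r <= 1.
  rewrite -ler_norml -(@expr_le1 _ 2)// real_normK ?num_real// expr_div_n r2.
  rewrite ler_pdivrMr ?mul1r ?lerDl ?sqr_ge0//.
  by rewrite -r2 lt_def sqrf_eq0 rN0 sqr_ge0.
have cx : x = r * cos (acos (x / r)) by rewrite acosK ?in_itv//= mulrC divfK.
have yE : r * sin (acos (x / r)) = `|y|.
  have e : (r * sin (acos (x / r))) ^+ 2 = y ^+ 2.
    have <- : r ^+ 2 - (r * cos (acos (x / r))) ^+ 2 = y ^+ 2 by rewrite -cx r2; ring.
    by rewrite !exprMn -[X in X - _]mulr1 -(cos2Dsin2 (acos (x / r))); ring.
  by rewrite -sqrtr_sqr -e sqrtr_sqr ger0_norm// mulr_ge0// sin_acos// sqrtr_ge0.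
have a0 := acos_ge0 xr; have api := acos_lepi xr.
(* The sine of an arccosine is nonnegative, so the sign of [y] decides the sign of [theta]. *)
have [y0|y0] := leP y 0.
  exists r, (acos (x / r)); split => //; first by lra.
  by rewrite yE ler0_norm// opprK.
exists r, (- acos (x / r)); split => //; first by lra.
  by rewrite cosN.
by rewrite sinN mulrN opprK yE gtr0_norm.
Qed.

Lemma H1_rcos r theta :
  H1per_deriv (fun t => r * cos (theta + t)) (fun t => - (r * sin (theta + t))).
Proof.
have := H1_scale r (H1_cos 1 theta).
by apply: H1_ext => t *; rewrite mul1r addrC// mulN1r mulrN.
Qed.

Lemma H1_rsin r theta :
  H1per_deriv (fun t => r * sin (theta + t)) (fun t => r * cos (theta + t)).
Proof.
have := H1_scale r (H1_sin 1 theta).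
by apply: H1_ext => t *; rewrite mul1r addrC// mul1r.
Qed.

Lemma Ipi_int_rcos r theta : J (fun t => r * cos (theta + t)) = 0.
Proof. exact: H1_int_deriv (H1_rsin r theta). Qed.

Lemma Ipi_int_rsin r theta : J (fun t => r * sin (theta + t)) = 0.
Proof.
rewrite (@Ipi_int_lincomb _ _ [:: (-1, fun t => - (r * sin (theta + t)))]) /=.
- by rewrite (H1_int_deriv (H1_rcos r theta)); ring.
- by split => //; have [] := H1_sqint_deriv (H1_rcos r theta).
- by move=> t _; ring.
Qed.

Lemma Ipi_int_rcos_sqr r theta :
  J (fun t => (r * cos (theta + t)) ^+ 2) = pi * r ^+ 2.
Proof.
rewrite (@Ipi_int_lincomb _ _
  [:: (r ^+ 2, fun t => cos (1%:R * t + theta) * cos (1%:R * t + theta))]).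
- by rewrite /= Ipi_int_cos_cos// subrr cos0; ring.
- by split => //; apply: integ_mul; exact: sqint_cos.
- by move=> t _ /=; rewrite mul1r (addrC t); ring.
Qed.

Lemma Ipi_int_rsin_sqr r theta :
  J (fun t => (r * sin (theta + t)) ^+ 2) = pi * r ^+ 2.
Proof.
have e := H1_by_parts (H1_rsin r theta) (H1_rcos r theta).
rewrite -(Ipi_int_rcos_sqr r theta).
transitivity (- J (fun t => r * sin (theta + t) * - (r * sin (theta + t)))).
  rewrite (@Ipi_int_lincomb _ _
    [:: (-1, fun t => r * sin (theta + t) * - (r * sin (theta + t)))]) /=.
  - by ring.
  - split => //; apply: integ_mul; first exact: H1_sqint (H1_rsin r theta).
    exact: H1_sqint_deriv (H1_rcos r theta).
  - by move=> t _; ring.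
by rewrite -e; apply: eq_Ipi_int => t _; rewrite expr2.
Qed.

Section Gap.
Variables (k d : R) (a da b db w dw : R -> R).
Hypotheses (d0 : d != 0).
Hypotheses (Ha : H1per_deriv a da) (Hb : H1per_deriv b db) (Hw : H1per_deriv w dw).

(** For [u = a tau + b n + w e3] the derivative is [(a' + b) tau + (b' - a) n + w' e3] and the
    squared length of [u x n] is [a ^ 2 + w ^ 2]; the constant being tested is [2 - d]. *)
Definition frame_gap : R :=
  J (fun t => (da t + b t) ^+ 2 + (db t - a t) ^+ 2 + dw t ^+ 2)
  + k * J (fun t => a t ^+ 2 + w t ^+ 2)
  - (2 - d) * J (fun t => a t ^+ 2 + b t ^+ 2 + w t ^+ 2).

(* For [d > 1] the two squares vanish together in the Fourier mode 1 only, with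
   the amplitudes of [b] and [a] in the ratio [2 / d]. *)
Lemma frame_gapE : frame_gap =
  J (fun t => (2 / d * (a t - mean a) - db t) ^+ 2)
  + (d - 1) * J (fun t => (2 / d * da t + (b t - mean b)) ^+ 2)
  + (1 - 2 / d) ^+ 2 * (J (fun t => da t ^+ 2) - J (fun t => (a t - mean a) ^+ 2))
  + (k + d - 4 / d) * J (fun t => (a t - mean a) ^+ 2)
  + 2 * pi * (k + d - 1) * mean a ^+ 2 + 2 * pi * (d - 1) * mean b ^+ 2
  + J (fun t => dw t ^+ 2) + (k + d - 2) * J (fun t => w t ^+ 2).
Proof.
have La := H1_sqint Ha; have Lb := H1_sqint Hb; have Lw := H1_sqint Hw.
have Lda := H1_sqint_deriv Ha; have Ldb := H1_sqint_deriv Hb.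
have Ldw := H1_sqint_deriv Hw.
have [Ia Iaa] := La; have [Ib Ibb] := Lb; have [_ Iww] := Lw.
have [Ida Idada] := Lda; have [Idb Idbdb] := Ldb; have [_ Idwdw] := Ldw.
have Ja := Ipi_int_mean a; have Jb := Ipi_int_mean b.
have Jda := H1_int_deriv Ha; have Jdb := H1_int_deriv Hb.
(* Reduces both mixed integrals to that of [a * db], after which the identity is purely
   algebraic. *)
have parts := H1_by_parts Ha Hb.
rewrite /frame_gap.
rewrite (@Ipi_int_lincomb _ (fun t => (da t + b t) ^+ 2 + _ + _)
  [:: (1, fun t => da t ^+ 2); (2, fun t => da t * b t); (1, fun t => b t ^+ 2);
      (1, fun t => db t ^+ 2); (- 2, fun t => a t * db t); (1, fun t => a t ^+ 2);
      (1, fun t => dw t ^+ 2)]); last 2 first.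
- by do ![split => //]; exact: integ_mul.
- by move=> t _ /=; ring.
rewrite (@Ipi_int_lincomb _ (fun t => a t ^+ 2 + w t ^+ 2)
  [:: (1, fun t => a t ^+ 2); (1, fun t => w t ^+ 2)]); last 2 first.
- by do ![split => //].
- by move=> t _ /=; ring.
rewrite (@Ipi_int_lincomb _ (fun t => a t ^+ 2 + b t ^+ 2 + w t ^+ 2)
  [:: (1, fun t => a t ^+ 2); (1, fun t => b t ^+ 2); (1, fun t => w t ^+ 2)]); last 2 first.
- by do ![split => //].
- by move=> t _ /=; ring.
rewrite (@Ipi_int_lincomb _ (fun t => (2 / d * (a t - mean a) - db t) ^+ 2)
  [:: (4 / d ^+ 2, fun t => a t ^+ 2); (- 8 / d ^+ 2 * mean a, a);
      (4 / d ^+ 2 * mean a ^+ 2, fun=> 1); (- 4 / d, fun t => a t * db t);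
      (4 / d * mean a, db); (1, fun t => db t ^+ 2)]); last 2 first.
- by do ![split => //]; [exact: integ_cst|exact: integ_mul].
- by move=> t _ /=; field.
rewrite (@Ipi_int_lincomb _ (fun t => (2 / d * da t + (b t - mean b)) ^+ 2)
  [:: (4 / d ^+ 2, fun t => da t ^+ 2); (4 / d, fun t => da t * b t);
      (- 4 / d * mean b, da); (1, fun t => b t ^+ 2);
      (- 2 * mean b, b); (mean b ^+ 2, fun=> 1)]); last 2 first.
- by do ![split => //]; [exact: integ_mul|exact: integ_cst].
- by move=> t _ /=; field.
rewrite (@Ipi_int_lincomb _ (fun t => (a t - mean a) ^+ 2)
  [:: (1, fun t => a t ^+ 2); (- 2 * mean a, a); (mean a ^+ 2, fun=> 1)]); last 2 first.
- by do ![split => //]; exact: integ_cst.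
- by move=> t _ /=; ring.
rewrite /= Ja Jb Jda Jdb parts !Ipi_int_cst.
by field.
Qed.

Hypotheses (k0 : 0 < k) (d1 : 1 <= d) (d2 : d < 2) (kd : 0 <= k + d - 4 / d).

(** Since [4 / d > 2], the coefficient of the norm of [w] is strictly positive, which forces [w = 0]
    in the equality case. *)
Let kd2 : 0 < k + d - 2.
Proof.
move: (d1) (d2) (kd) => D1 D2 D.
have : 2 < 4 / d by rewrite ltr_pdivlMr; lra.
lra.
Qed.

(** Only the third term needs an inequality between integrals, namely Wirtinger's for the centred
    [a]; the others are squares with nonnegative coefficients. *)
Let gap_terms : [/\
  0 <= J (fun t => (2 / d * (a t - mean a) - db t) ^+ 2),
  0 <= (d - 1) * J (fun t => (2 / d * da t + (b t - mean b)) ^+ 2),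
  0 <= (1 - 2 / d) ^+ 2 *
    (J (fun t => da t ^+ 2) - J (fun t => (a t - mean a) ^+ 2)) &
  0 <= (k + d - 4 / d) * J (fun t => (a t - mean a) ^+ 2)] /\
  [/\ 0 <= 2 * pi * (k + d - 1) * mean a ^+ 2,
  0 <= 2 * pi * (d - 1) * mean b ^+ 2, 0 <= J (fun t => dw t ^+ 2) &
  0 <= (k + d - 2) * J (fun t => w t ^+ 2)].
Proof.
move: (d1) (d2) (k0) (@pi_ge0 R) => D1 D2 K0 pi0.
have sq f : 0 <= J (fun t => f t ^+ 2) by apply: Ipi_int_ge0 => t _; exact: sqr_ge0.
have [W _] := wirtinger (H1_center Ha) (Ipi_int_center (sqint_integ (H1_sqint Ha))).
split; split; rewrite ?sq//.
- by rewrite mulr_ge0 ?sq// subr_ge0.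
- by rewrite mulr_ge0 ?sqr_ge0// subr_ge0.
- by rewrite mulr_ge0 ?sq.
- by rewrite mulr_ge0 ?sqr_ge0// mulr_ge0; lra.
- by rewrite mulr_ge0 ?sqr_ge0// mulr_ge0; lra.
- by rewrite mulr_ge0 ?sq// ltW.
Qed.

Lemma frame_gap_ge0 : 0 <= frame_gap.
Proof. rewrite frame_gapE; move: gap_terms => [[? ? ? ?] [? ? ? ?]]; lra. Qed.

(** [r] and [theta] are the amplitude and phase of Fourier mode 1, and [n] is the mean of the normal
    component. *)
Definition frame_extremal r theta n : Prop := forall t, I t ->
  [/\ a t = r * cos (theta + t), b t = n + 2 / d * r * sin (theta + t) & w t = 0].

(** All eight nonnegative terms vanish. The fifth kills the mean of [a], the third puts [a] in the
    equality case of Wirtinger, the first determines [b] up to its mean, and the last two kill [w].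
    The fourth and sixth become the conditions on [r] and [n]. *)
Lemma frame_gap_eq0 : frame_gap = 0 -> exists r theta n,
  [/\ 0 <= r, - pi <= theta <= pi, frame_extremal r theta n, (d - 1) * n = 0 &
      (k + d - 4 / d) * r = 0].
Proof.
move: (gap_terms) => [[T1 T2 T3 T4] [T5 T6 T7 T8]].
move: (d1) (d2) (k0) (kd2) (@pi_gt0 R) => D1 D2 K0 KD pi0.
rewrite frame_gapE => E0.
have dp : 0 < d by lra.
have sq f : 0 <= J (fun t => f t ^+ 2) by apply: Ipi_int_ge0 => t _; exact: sqr_ge0.
have E1 : J (fun t => (2 / d * (a t - mean a) - db t) ^+ 2) = 0 by lra.
have E3 : (1 - 2 / d) ^+ 2 *
    (J (fun t => da t ^+ 2) - J (fun t => (a t - mean a) ^+ 2)) = 0 by lra.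
have E4 : (k + d - 4 / d) * J (fun t => (a t - mean a) ^+ 2) = 0 by lra.
have E5 : 2 * pi * (k + d - 1) * mean a ^+ 2 = 0 by lra.
have E6 : 2 * pi * (d - 1) * mean b ^+ 2 = 0 by lra.
have E7 : J (fun t => dw t ^+ 2) = 0 by lra.
have E8 : (k + d - 2) * J (fun t => w t ^+ 2) = 0 by lra.
have ma : mean a = 0.
  apply/eqP; move/eqP: E5; rewrite mulf_eq0 sqrf_eq0 => /orP[|//].
  by rewrite gt_eqF// mulr_gt0; lra.
have db1 : 1 - 2 / d != 0.
  have h : 1 < 2 / d by rewrite ltr_pdivlMr// mul1r.
  by rewrite lt_eqF// subr_lt0.
have [_ W] := wirtinger (H1_center Ha) (Ipi_int_center (sqint_integ (H1_sqint Ha))).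
have [|A [B AB]] := W.
  move/eqP: E3; rewrite mulf_eq0 sqrf_eq0 (negPf db1)/= subr_eq0.
  by move=> /eqP.
have [r [theta [r0 th Ar Br]]] := polar_form A B.
have aE t : I t -> a t = r * cos (theta + t).
  by move=> /AB; rewrite ma subr0 => ->; rewrite Ar Br cosD; ring.
exists r, theta, (mean b); split => //.
- move=> t It; split; first exact: aE.
  (* The function [b - 2 / d * r * sin (theta + t)] has null derivative by [E1], so it equals its
     mean, which is that of [b]. *)
  + have H := H1_add Hb (H1_scale (- (2 / d)) (H1_rsin r theta)).
    have Z : J (fun t => (db t + - (2 / d) * (r * cos (theta + t))) ^+ 2) = 0.
      rewrite -E1; apply: eq_Ipi_int => s /aE e.
      by rewrite ma subr0 e; ring.
    have := H1_null_deriv H Z It.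
    have -> : mean (fun t => b t + - (2 / d) * (r * sin (theta + t))) = mean b.
      rewrite /mean; congr (_ / _).
      rewrite (@Ipi_int_lincomb _ _ [:: (1, b);
         (- (2 / d), fun t => r * sin (theta + t))]) /=.
      - by rewrite Ipi_int_rsin; ring.
      - split; first exact/sqint_integ/H1_sqint/Hb.
        by split => //; exact/sqint_integ/H1_sqint/H1_rsin.
      - by move=> s _; ring.
    by move=> <-; ring.
  (* A null derivative makes [w] constant, and its zero norm makes this constant 0. *)
  + rewrite (H1_null_deriv Hw E7 It) /mean.
    have w0 : J (fun t => w t ^+ 2) = 0.
      by move/eqP: E8; rewrite mulf_eq0 gt_eqF//= => /eqP.
    have := Ipi_int_null_mul (H1_sqint Hw) (sqint_cst 1) w0.
    have -> : J (fun t => w t * 1) = J w by apply: eq_Ipi_int => s _; rewrite mulr1.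
    by move=> ->; rewrite mul0r.
- move/eqP: E6; rewrite mulf_eq0 sqrf_eq0 => /orP[|/eqP->]; last by rewrite mulr0.
  by rewrite mulf_eq0 gt_eqF ?mulr_gt0//= => /eqP->; rewrite mul0r.
- apply/eqP; move/eqP: E4; rewrite ma.
  have -> : J (fun t => (a t - 0) ^+ 2) = J (fun t => (r * cos (theta + t)) ^+ 2).
    by apply: eq_Ipi_int => t /aE ->; rewrite subr0.
  by rewrite Ipi_int_rcos_sqr mulf_eq0 mulf_eq0 sqrf_eq0 (gt_eqF pi0)/= mulf_eq0.
Qed.

(** The terms of [frame_gapE] vanish one by one. As [da] and [db] are known only almost everywhere,
    they are compared with the explicit derivatives through null L2 norms. *)
Lemma frame_extremal_gap r theta n : frame_extremal r theta n ->
  (d - 1) * n = 0 -> (k + d - 4 / d) * r = 0 -> frame_gap = 0.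
Proof.
move=> ext dn kr; rewrite frame_gapE.
have aE t : I t -> a t = r * cos (theta + t) by case/ext.
have bE t : I t -> b t = n + 2 / d * r * sin (theta + t) by case/ext.
have wE t : I t -> w t = 0 by case/ext.
have pi0 : pi != 0 :> R by rewrite gt_eqF// pi_gt0.
have ma : mean a = 0.
  by rewrite /mean (eq_Ipi_int aE) Ipi_int_rcos mul0r.
have mb : mean b = n.
  rewrite /mean (eq_Ipi_int bE) (@Ipi_int_lincomb _ _ [:: (1, fun=> n);
    (2 / d, fun t => r * sin (theta + t))]) /=.
  - by rewrite Ipi_int_rsin Ipi_int_cst mulr0 !addr0 mul1r mulrC mulKf ?mulf_neq0 ?pnatr_eq0.
  - split; first exact: integ_cst.
    by split => //; exact/sqint_integ/H1_sqint/H1_rsin.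
  - by move=> s _; ring.
have HS := H1_rsin r theta; have HC := H1_rcos r theta.
have T1 : J (fun t => (2 / d * (a t - mean a) - db t) ^+ 2) = 0.
  have H := H1_add (H1_add Hb (H1_cst (- n))) (H1_scale (- (2 / d)) HS).
  rewrite -[RHS](H1_zero_deriv H).
    by apply: eq_Ipi_int => t It; rewrite aE// ma; ring.
  by move=> t It; rewrite bE//; ring.
have He := H1_add Ha (H1_scale (-1) HC).
have e0 : J (fun t => (da t + -1 * - (r * sin (theta + t))) ^+ 2) = 0.
  by apply: (H1_zero_deriv He) => t It; rewrite aE//; ring.
have T2 : J (fun t => (2 / d * da t + (b t - mean b)) ^+ 2) = 0.
  rewrite (@Ipi_int_lincomb _ _ [:: ((2 / d) ^+ 2,
    fun t => (da t + -1 * - (r * sin (theta + t))) ^+ 2)]) /=.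
  - by rewrite e0; ring.
  - by split => //; have [] := H1_sqint_deriv He.
  - by move=> t It; rewrite bE// mb; ring.
have T3 : J (fun t => da t ^+ 2) = J (fun t => (a t - mean a) ^+ 2).
  have -> : J (fun t => (a t - mean a) ^+ 2) = pi * r ^+ 2.
    rewrite -(Ipi_int_rcos_sqr r theta).
    by apply: eq_Ipi_int => t It; rewrite aE// ma subr0.
  rewrite -(Ipi_int_rsin_sqr r theta).
  (* Writing [da] as a null function minus [r * sin (theta + t)], the mixed term of its square
     integrates to 0. *)
  have null := Ipi_int_null_mul (H1_sqint_deriv He) (H1_sqint HS) e0.
  rewrite (@Ipi_int_lincomb _ _ [::
    (1, fun t => (da t + -1 * - (r * sin (theta + t))) ^+ 2);
    (- 2, fun t => (da t + -1 * - (r * sin (theta + t))) * (r * sin (theta + t)));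
    (1, fun t => (r * sin (theta + t)) ^+ 2)]) /=.
  - by rewrite e0 null; ring.
  - split; first by have [] := H1_sqint_deriv He.
    split; first exact: integ_mul (H1_sqint_deriv He) (H1_sqint HS).
    by split => //; have [] := H1_sqint HS.
  - by move=> t _; ring.
have T4 : (k + d - 4 / d) * J (fun t => (a t - mean a) ^+ 2) = 0.
  have -> : J (fun t => (a t - mean a) ^+ 2) = r * (pi * r).
    rewrite mulrCA -expr2 -(Ipi_int_rcos_sqr r theta).
    by apply: eq_Ipi_int => t It; rewrite aE// ma subr0.
  by rewrite mulrA kr mul0r.
have w0 : J (fun t => w t ^+ 2) = 0.
  rewrite (@Ipi_int_lincomb _ _ [::])// => t It /=.
  by rewrite wE// expr0n.
rewrite T1 T2 T3 T4 subrr (H1_zero_deriv Hw wE) w0 ma mb.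
have -> : 2 * pi * (d - 1) * n ^+ 2 = 2 * pi * ((d - 1) * n * n) by ring.
by rewrite dn; ring.
Qed.

Lemma frame_norm r theta n : frame_extremal r theta n ->
  J (fun t => a t ^+ 2 + b t ^+ 2 + w t ^+ 2) =
  pi * r ^+ 2 * (1 + 4 / d ^+ 2) + 2 * pi * n ^+ 2.
Proof.
move=> ext; have HS := H1_rsin r theta; have HC := H1_rcos r theta.
rewrite (@Ipi_int_lincomb _ _ [:: (1, fun t => (r * cos (theta + t)) ^+ 2);
  (n ^+ 2, fun=> 1); (4 / d * n, fun t => r * sin (theta + t));
  (4 / d ^+ 2, fun t => (r * sin (theta + t)) ^+ 2)]) /=.
- by rewrite Ipi_int_rcos_sqr Ipi_int_cst Ipi_int_rsin Ipi_int_rsin_sqr; field.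
- split; first by have [] := H1_sqint HC.
  split; first exact: integ_cst.
  split; first by have [] := H1_sqint HS.
  by split => //; have [] := H1_sqint HS.
- by move=> t /ext[-> -> ->]; field.
Qed.

End Gap.
End Frame.

(** * From the vector field to its tangential and normal components *)

Section Energy.
Context {R : realType}.
Implicit Types (t theta r n k : R) (u du : R -> vec3 R).
Notation I := (@Ipi R).
Notation J := (@Ipi_int R).

Definition tau_part u t : R := - v1 (u t) * sin t + v2 (u t) * cos t.
Definition nor_part u t : R := v1 (u t) * cos t + v2 (u t) * sin t.

Lemma frame_coordinates (v : vec3 R) t (x y : R) :
  v = vadd (vscale x (tauvec t)) (vscale y (nvec t)) <->
  [/\ - v1 v * sin t + v2 v * cos t = x, v1 v * cos t + v2 v * sin t = y & v3 v = 0].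
Proof.
have e := cos2Dsin2 t.
case: v => [[p q] z]; rewrite /vadd /vscale /v1 /v2 /v3 /=; split.
  move=> [-> -> ->]; split; last by ring.
    by rewrite -[x in RHS]mulr1 -e; ring.
  by rewrite -[y in RHS]mulr1 -e; ring.
move=> [<- <- ->]; congr (_, _, _); last by ring.
  by rewrite -[p in LHS]mulr1 -e; ring.
by rewrite -[q in LHS]mulr1 -e; ring.
Qed.

Lemma frame_norm2 u t : vnorm2 (u t) =
  tau_part u t ^+ 2 + nor_part u t ^+ 2 + v3 (u t) ^+ 2.
Proof.
rewrite /vnorm2 /vdot /tau_part /nor_part.
transitivity ((v1 (u t) ^+ 2 + v2 (u t) ^+ 2) * (cos t ^+ 2 + sin t ^+ 2) + v3 (u t) ^+ 2).
  by rewrite cos2Dsin2; ring.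
by ring.
Qed.

Lemma L2sq_frame u : L2sq u =
  J (fun t => tau_part u t ^+ 2 + nor_part u t ^+ 2 + v3 (u t) ^+ 2).
Proof. by apply: eq_Ipi_int => t _; exact: frame_norm2. Qed.

(** Product rule with the frame vector [tau], whose derivative is [- n]. *)
Lemma H1_tau_part u du : H1sharp3 u du ->
  H1per_deriv (tau_part u) (fun t => tau_part du t - nor_part u t).
Proof.
have Hc := @H1_rcos R 1 0; have Hs := @H1_rsin R 1 0.
move=> [H1 H2 _].
have := H1_add (H1_scale (-1) (H1_mul H1 Hs)) (H1_mul H2 Hc).
by apply: H1_ext => t *; rewrite /tau_part /nor_part !add0r; ring.
Qed.

Lemma H1_nor_part u du : H1sharp3 u du ->
  H1per_deriv (nor_part u) (fun t => nor_part du t + tau_part u t).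
Proof.
have Hc := @H1_rcos R 1 0; have Hs := @H1_rsin R 1 0.
move=> [H1 H2 _].
have := H1_add (H1_mul H1 Hc) (H1_mul H2 Hs).
by apply: H1_ext => t *; rewrite /tau_part /nor_part !add0r; ring.
Qed.

Lemma energy_frame_gap k u du : H1sharp3 u du ->
  energy k u du - c2 k * L2sq u =
  frame_gap k (2 - c2 k) (tau_part u) (fun t => tau_part du t - nor_part u t)
    (nor_part u) (fun t => nor_part du t + tau_part u t)
    (fun t => v3 (u t)) (fun t => v3 (du t)).
Proof.
move=> Hu; rewrite /frame_gap -L2sq_frame opprB addrCA subrr addr0.
congr (_ + k * _ - _).
  apply: eq_Ipi_int => t _; rewrite frame_norm2.
  by congr (_ ^+ 2 + _ ^+ 2 + _); ring.
apply: eq_Ipi_int => t _; rewrite /vnorm2 /vdot /vcross /nvec /v1 /v2 /v3 /=.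
rewrite /tau_part /v1 /v2.
move: (u t) => [[p q] z] /=.
transitivity (z ^+ 2 * (cos t ^+ 2 + sin t ^+ 2) + (p * sin t - q * cos t) ^+ 2).
  by ring.
by rewrite cos2Dsin2; ring.
Qed.

(** For [k < 3], [d = (omega2 k - k) / 2] is the positive root of [d ^ 2 + k * d = 4], hence
    [k + d = 4 / d]. For [3 <= k], [d = 1] and the last coefficient is [k - 3]. *)
Lemma c2_facts k : 0 < k -> let d := 2 - c2 k in
  [/\ 1 <= d, d < 2 & 0 <= k + d - 4 / d] /\
  ((3 <= k -> d = 1) /\ (k < 3 -> 1 < d /\ d ^+ 2 + k * d = 4)).
Proof.
move=> k0 d; rewrite /d /c2.
have [k3|k3] := leP 3 k.
  have -> : 2 - 1 = 1 :> R by ring.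
  rewrite divr1; split; [split; lra|split => //; lra].
have w2 : omega2 k ^+ 2 = k ^+ 2 + 16.
  by rewrite /omega2 sqr_sqrtr// addr_ge0// sqr_ge0.
have w0 : 0 <= omega2 k by exact: sqrtr_ge0.
set w := omega2 k in w2 w0 *.
(* After squaring, this bound amounts to [k < 3] and the next one to [0 < k]; they give [1 < d] and
   [d < 2]. *)
have w_gt : k + 2 < w by rewrite -(@ltr_pXn2r _ 2) ?nnegrE//; nra.
have w_lt : w < k + 4 by rewrite -(@ltr_pXn2r _ 2) ?nnegrE//; nra.
set e := 2 - _.
have eE : e = (w - k) / 2 by rewrite /e; field.
have e4 : e ^+ 2 + k * e = 4.
  have -> : e ^+ 2 + k * e = (w ^+ 2 - k ^+ 2) / 4 by rewrite eE; field.
  by rewrite w2; field.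
have e1 : 1 < e by lra.
split; last by split => //; lra.
split; [lra|lra|].
have -> : 4 / e = e + k by rewrite -e4; field; rewrite gt_eqF//; lra.
lra.
Qed.

Lemma energy_ge k u du : 0 < k -> H1sharp3 u du -> c2 k * L2sq u <= energy k u du.
Proof.
move=> k0 Hu; rewrite -subr_ge0 (energy_frame_gap _ Hu).
have [[d1 d2 kd] _] := c2_facts k0; have [_ _ Hw] := Hu.
apply: frame_gap_ge0 => //; [|exact: H1_tau_part|exact: H1_nor_part].
by rewrite gt_eqF//; lra.
Qed.

(** The product conditions state the trichotomy: [n] may be nonzero only if [d = 1], that is
    [3 <= k], and [r] only if [k + d = 4 / d], that is [k <= 3]. Both survive only at [k = 3]. *)
Definition extremal k u r theta n : Prop :=
  let d := 2 - c2 k in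
  frame_extremal d (tau_part u) (nor_part u) (fun t => v3 (u t)) r theta n /\
  ((d - 1) * n = 0 /\ (k + d - 4 / d) * r = 0).

Lemma energy_eqP k u du : 0 < k -> H1sharp3 u du ->
  energy k u du = c2 k * L2sq u <->
  exists r theta n, [/\ 0 <= r, - pi <= theta <= pi & extremal k u r theta n].
Proof.
move=> k0 Hu; have [[d1 d2 kd] _] := c2_facts k0; have [_ _ Hw] := Hu.
have d0 : 2 - c2 k != 0 by rewrite gt_eqF//; lra.
have Ha := H1_tau_part Hu; have Hb := H1_nor_part Hu.
have := energy_frame_gap k Hu => e; split=> [eq|[r [theta [n [_ _ [ext [dn kr]]]]]]].
  move: e; rewrite eq subrr => /esym.
  move=> /(frame_gap_eq0 d0 Ha Hb Hw k0 d1 d2 kd)[r [theta [n [r0 th ext dn kr]]]].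
  by exists r, theta, n; split.
apply/eqP; rewrite -subr_eq0 e; apply/eqP.
exact: (frame_extremal_gap d0 Ha Hb Hw ext dn kr).
Qed.

Lemma extremal_L2sq k u r theta n : 0 < k -> extremal k u r theta n ->
  L2sq u = pi * r ^+ 2 * (1 + 4 / (2 - c2 k) ^+ 2) + 2 * pi * n ^+ 2.
Proof.
move=> k0 [ext _]; rewrite L2sq_frame; apply: frame_norm ext => //.
by have [[d1 _ _] _] := c2_facts k0; rewrite gt_eqF//; lra.
Qed.

(** Identifies the tangent of [phik k] as [d / 2], which matches the amplitude ratio [2 / d] of the
    extremals. The double angle has tangent [4 / k], giving a quadratic equation for that
    tangent. *)
Lemma phik_facts k (s := sin (phik k)) (c := cos (phik k)) : 0 < k -> k < 3 ->
  let d := 2 - c2 k in [/\ 0 < s, 0 < c & s * 2 = d * c].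
Proof.
move=> k0 k3 d; have [[d1 d2 _] [_ /(_ k3)[_ d4]]] := c2_facts k0.
rewrite -/d in d1 d2 d4.
have pi0 := @pi_gt0 R.
have at0 : 0 < atan (4 / k).
  by rewrite -(@atan0 R); apply: lt_atan; rewrite divr_gt0.
have atpi := @atan_ltpi2 R (4 / k).
have s0 : 0 < s by apply: sin_gt0_pihalf; rewrite /phik; lra.
have c0 : 0 < c by apply: cos_gt0_pihalf; rewrite /phik; lra.
split => //.
have e : k * (2 * (s * c)) = 4 * (c ^+ 2 - s ^+ 2).
  have C : 0 < cos (atan (4 / k)) by apply: cos_gt0_pihalf; lra.
  have := @atanK R (4 / k); rewrite /tan => /eqP.
  rewrite (eqr_div _ _ (lt0r_neq0 C) (lt0r_neq0 k0)) => /eqP.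
  have -> : atan (4 / k) = phik k + phik k by rewrite /phik; field.
  by rewrite sinD cosD -/s -/c => h; rewrite !expr2; lra.
(* The roots of the quadratic are [d / 2] and [- (d + k) / 2]; positivity of [s] and [c] excludes
   the second. *)
have : (s * 2 - d * c) * (s * 2 + (d + k) * c) = 0.
  have -> : (s * 2 - d * c) * (s * 2 + (d + k) * c) =
    4 * s ^+ 2 + k * (2 * (s * c)) - (d ^+ 2 + k * d) * c ^+ 2 by ring.
  by rewrite e d4; ring.
move/eqP; rewrite mulf_eq0 subr_eq0 => /orP[/eqP//|].
by rewrite gt_eqF// addr_gt0// mulr_gt0//; lra.
Qed.

End Energy.

(** * Equality cases *)

Section EqualityCases.
Context {R : realType}.
Implicit Types (t theta r n k : R) (u du : R -> vec3 R).
Notation mu := (@lebesgue_measure R).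
Notation I := (@Ipi R).
Notation J := (@Ipi_int R).

Lemma extremalP k u r theta n (d := 2 - c2 k) : extremal k u r theta n <->
  [/\ forall t, I t -> u t = vadd (vscale (r * cos (theta + t)) (tauvec t))
        (vscale (n + 2 / d * r * sin (theta + t)) (nvec t)),
      (d - 1) * n = 0 & (k + d - 4 / d) * r = 0].
Proof.
split=> [[ext [dn kr]]|[ext dn kr]].
  by split => // t /ext[a b w]; apply/frame_coordinates.
split => // t /ext /frame_coordinates[a b w].
by split.
Qed.

Lemma extremal_v3 k u r theta n : extremal k u r theta n ->
  forall t, I t -> v3 (u t) = 0.
Proof. by move=> [ext _] t /ext[]. Qed.

Let vadd0 t (y : R) :
  vadd (vscale 0 (tauvec t)) (vscale y (nvec t)) = vscale y (nvec t).
Proof. by rewrite /vadd /vscale /v1 /v2 /v3 /= !mul0r !add0r. Qed.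

Let vscale1 (v : vec3 R) : vscale 1 v = v.
Proof. by case: v => [[? ?] ?]; rewrite /vscale /v1 /v2 /v3 /= !mul1r. Qed.

Let extremal_zero k u n (d := 2 - c2 k) : extremal k u 0 0 n <->
  (forall t, I t -> u t = vscale n (nvec t)) /\ (d - 1) * n = 0.
Proof.
split=> [/extremalP[e dn _]|[e dn]].
  by split => // t /e; rewrite mulr0 !mul0r addr0 vadd0.
by apply/extremalP; split; rewrite ?mulr0// => t /e ->; rewrite !mul0r addr0 vadd0.
Qed.

(** The coefficient [k - 3] of [r] is positive, so [r = 0], and the normalization becomes
    [n ^ 2 = 1]. *)
Lemma equality_case_gt3 k u : 3 < k -> L2sq u = 2 * pi ->
  (exists r theta n, [/\ 0 <= r, - pi <= theta <= pi & extremal k u r theta n]) <->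
  equality_case k u.
Proof.
move=> k3 L; have k0 : 0 < k by lra.
have [_ [/(_ (ltW k3)) d1 _]] := c2_facts k0.
have pi0 := @pi_gt0 R.
rewrite /equality_case k3; split=> [[r [theta [n [r0 th ext]]]]|[_ eq]].
  have r00 : r = 0.
    have [_ [_ /eqP]] := ext; rewrite d1 mulf_eq0 => /orP[|/eqP//].
    by rewrite gt_eqF//; lra.
  have := extremal_L2sq k0 ext; rewrite L r00 expr0n/= mulr0 mul0r add0r.
  move=> /eqP; rewrite -{1}[2 * pi]mulr1 (inj_eq (mulfI _)) ?mulf_neq0 ?pnatr_eq0 ?lt0r_neq0//.
  rewrite eq_sym sqrf_eq1 => n1.
  split; first exact: extremal_v3 ext.
  have /extremalP[e _ _] := ext.
  case/orP: n1 => /eqP n1; [left|right] => t /e ->;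
    by rewrite r00 n1 mulr0 !mul0r addr0 vadd0 ?vscale1.
have pp : - pi <= (0 : R) <= pi by lra.
case: eq => eq; [exists 0, 0, 1|exists 0, 0, (-1)]; split => //; apply/extremal_zero.
  by split; [move=> t It; rewrite eq// vscale1|rewrite d1 subrr mul0r].
by split; [move=> t It; rewrite eq//|rewrite d1 subrr mul0r].
Qed.

(** Here [d = 1] and both amplitudes are free. With [r = sqrt 2 * rho] the normalization reads
    [n ^ 2 = 1 - 5 * rho ^ 2], whose nonnegativity is the bound on [rho]. *)
Lemma equality_case_eq3 u : L2sq u = 2 * pi ->
  (exists r theta n, [/\ 0 <= r, - pi <= theta <= pi & extremal 3 u r theta n]) <->
  equality_case 3 u.
Proof.
move=> L; have k0 : 0 < 3 :> R by [].
have [_ [/(_ (lexx _)) d1 _]] := c2_facts k0.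
have pi0 := @pi_gt0 R.
have s2 : Num.sqrt 2 ^+ 2 = 2 :> R by rewrite sqr_sqrtr.
have s5 : Num.sqrt 5 ^+ 2 = 5 :> R by rewrite sqr_sqrtr.
have s2p : 0 < Num.sqrt 2 :> R by rewrite sqrtr_gt0.
have s5p : 0 < Num.sqrt 5 :> R by rewrite sqrtr_gt0.
rewrite /equality_case ltxx eqxx; split=> [[r [theta [n [r0 th ext]]]]|].
  have := extremal_L2sq k0 ext; rewrite L d1 => N.
  split; first exact: extremal_v3 ext.
  have [e _ _] := (extremalP _ _ _ _ _).1 ext.
  pose rho := r / Num.sqrt 2.
  have rE : r = Num.sqrt 2 * rho by rewrite /rho mulrC divfK// lt0r_neq0.
  have n2 : n ^+ 2 = 1 - 5 * rho ^+ 2.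
    have r2 : r ^+ 2 = 2 * rho ^+ 2 by rewrite rE exprMn s2.
    apply: (mulfI (lt0r_neq0 (_ : 0 < 2 * pi))); first by rewrite mulr_gt0.
    by move: N; rewrite r2 expr1n; lra.
  have nE : `|n| = Num.sqrt (1 - 5 * rho ^+ 2) by rewrite -n2 sqrtr_sqr.
  (* The sign in the statement is that of [n]. *)
  exists theta, rho, (if 0 <= n then 1 else -1); split => //.
  - have rho0 : 0 <= rho by rewrite divr_ge0// ltW.
    rewrite rho0/= ler_pdivlMr// -(@expr_le1 _ 2)// ?mulr_ge0// ?(ltW s5p)//.
    by rewrite exprMn s5; have := sqr_ge0 n; lra.
  - by case: ifP => _; [left|right].
  - move=> t It; rewrite e// -nE d1 divr1.
    have -> : (if 0 <= n then 1 else -1) * `|n| = n.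
      have [n0|n0] := leP 0 n; first by rewrite mul1r ger0_norm.
      by rewrite mulN1r ltr0_norm// opprK.
    by rewrite rE !mulrA.
move=> [_ [theta [rho [s [th /andP[rho0 rho1] s1 e]]]]].
exists (Num.sqrt 2 * rho), theta, (s * Num.sqrt (1 - 5 * rho ^+ 2)).
split => //; first by rewrite mulr_ge0// ltW.
apply/extremalP; split.
- by move=> t It; rewrite e// d1 divr1 !mulrA.
- by rewrite d1 subrr mul0r.
- by rewrite d1 divr1 (_ : 3 + 1 - 4 = 0) ?mul0r//; ring.
Qed.

(** Since [1 < d], [n = 0]. The normalization [r ^ 2 * (1 + 4 / d ^ 2) = 2] and the ratio [2 / d] of
    cosine to sine of [phik k] give [r = sqrt 2 * sin (phik k)]. *)
Lemma equality_case_lt3 k u : 0 < k -> k < 3 -> L2sq u = 2 * pi ->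
  (exists r theta n, [/\ 0 <= r, - pi <= theta <= pi & extremal k u r theta n]) <->
  equality_case k u.
Proof.
move=> k0 k3 L.
have [[d1 d2 _] [_ /(_ k3)[d1' d4]]] := c2_facts k0.
have [s0 c0 sc] := phik_facts k0 k3.
set d := 2 - c2 k in d1 d2 d1' d4 sc.
have pi0 := @pi_gt0 R.
have s2 : Num.sqrt 2 ^+ 2 = 2 :> R by rewrite sqr_sqrtr.
have s2p : 0 < Num.sqrt 2 :> R by rewrite sqrtr_gt0.
have dN : d != 0 by rewrite gt_eqF//; lra.
have cE : cos (phik k) = 2 / d * sin (phik k).
  by rewrite mulrAC mulrC (mulrC 2) sc mulKf.
rewrite /equality_case ltNge (ltW k3)/= lt_eqF//.
split=> [[r [theta [n [r0 th ext]]]]|].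
  have := extremal_L2sq k0 ext; rewrite L -/d => N.
  split; first exact: extremal_v3 ext.
  have [e dn _] := (extremalP _ _ _ _ _).1 ext.
  have n0 : n = 0.
    by move/eqP: dn; rewrite mulf_eq0 gt_eqF ?subr_gt0//= => /eqP.
  exists theta; split => // t It; rewrite e// n0 add0r -/d.
  have rE : r = Num.sqrt 2 * sin (phik k).
    apply/eqP; rewrite -(@eqrXn2 _ 2)// ?mulr_ge0 ?ltW// exprMn s2; apply/eqP.
    have q0 : 0 < pi * (1 + 4 / d ^+ 2).
      by rewrite mulr_gt0// addr_gt0// divr_gt0// exprn_gt0//; lra.
    apply: (mulfI (lt0r_neq0 q0)).
    transitivity (2 * pi : R); first by rewrite N n0; ring.
    have e1 := cos2Dsin2 (phik k); rewrite cE in e1.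
    rewrite -[LHS]mulr1 -[X in _ * X = _]e1; by field.
  by rewrite cE rE; congr (vadd _ (vscale _ _)); ring.
move=> [_ [theta [th e]]].
exists (Num.sqrt 2 * sin (phik k)), theta, 0; split => //.
  by rewrite mulr_ge0 ?ltW.
apply/extremalP; split.
- move=> t It; rewrite e// cE; congr (vadd _ (vscale _ _)).
  by rewrite -/d; ring.
- by rewrite mulr0.
- have -> : k + (2 - c2 k) - 4 / (2 - c2 k) = 0 by rewrite -/d -d4; field.
  by rewrite mul0r.
Qed.

Lemma equality_caseP k u : 0 < k -> L2sq u = 2 * pi ->
  (exists r theta n, [/\ 0 <= r, - pi <= theta <= pi & extremal k u r theta n]) <->
  equality_case k u.
Proof.
move=> k0 L; have [k3|k3|->] := ltgtP k 3.
- exact: equality_case_lt3.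
- exact: equality_case_gt3.
- exact: equality_case_eq3.
Qed.

(** Unit length is exploited through two test functions: the constant 1, for the norm, and the
    frequency-2 cosine, for the oscillation. *)
Lemma Ipi_int_ae_one f h : {ae mu, forall t, I t -> f t = 1} ->
  sqint f -> sqint h -> J (fun t => f t * h t) = J h.
Proof.
move=> f1 Lf Lh; rewrite /Ipi_int /Rintegral; congr fine.
apply: ae_eq_integral.
- exact: measurable_itv.
- exact: (measurable_int mu (integ_mul Lf Lh)).
- exact: (measurable_int mu (sqint_integ Lh)).
- case: f1 => N [mN N0 subN]; exists N; split => // t /= nt; apply: subN => ft.
  by apply: nt => It; rewrite ft// mul1r.
Qed.

(* On a minimiser [vnorm2 (u t)] is a constant plus a multiple of
   [cos (2 * (theta + t))]; unit length kills the oscillating part. *)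
Lemma extremal_not_unit k u r theta n : 0 < k -> k < 3 -> extremal k u r theta n ->
  ~ {ae mu, forall t, I t -> vnorm2 (u t) = 1}.
Proof.
move=> k0 k3 ext ae1.
have [[d1 d2 _] [_ /(_ k3)[d1' _]]] := c2_facts k0.
have := extremal_L2sq k0 ext.
have [F [dn _]] := ext.
set d := 2 - c2 k in d1 d2 d1' dn F *.
have dN : d != 0 by rewrite gt_eqF//; lra.
have n0 : n = 0.
  by move/eqP: dn; rewrite mulf_eq0 gt_eqF ?subr_gt0//= => /eqP.
pose p := r ^+ 2 * (1 + 4 / d ^+ 2) / 2.
pose q := r ^+ 2 * (1 - 4 / d ^+ 2) / 2.
pose C t := cos (2%:R * t + 2 * theta).
have LC : sqint C by exact: sqint_cos.
have normE t : I t -> vnorm2 (u t) = p + q * C t.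
  move=> /F[a b w]; rewrite frame_norm2 a b w n0 /p /q /C.
  have -> : 2%:R * t + 2 * theta = (theta + t) + (theta + t) by ring.
  move: (theta + t) => x; rewrite cosD.
  have c2E : cos x ^+ 2 = 1 - sin x ^+ 2 by rewrite -(cos2Dsin2 x); ring.
  transitivity (r ^+ 2 * cos x ^+ 2 + 4 / d ^+ 2 * r ^+ 2 * sin x ^+ 2).
    by field.
  by rewrite -!expr2 c2E; field.
have Lu : sqint (fun t => vnorm2 (u t)).
  apply: (@sqint_ext _ (fun t => p + q * C t)); first by move=> t /normE ->.
  by apply: sqint_add; [exact: sqint_cst|exact: sqint_scale].
have L2 : L2sq u = 2 * pi.
  rewrite /L2sq -(mulr1 (2 * pi)) -Ipi_int_cst -(Ipi_int_ae_one ae1 Lu (sqint_cst 1)).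
  by apply: eq_Ipi_int => t _; rewrite mulr1.
have JC : J C = 0 by rewrite Ipi_int_cos.
have := Ipi_int_ae_one ae1 Lu LC; rewrite JC.
rewrite (@Ipi_int_lincomb _ _ [:: (p, C); (q, fun t => C t * C t)]) /=; last 2 first.
- split; first exact: sqint_integ.
  by split => //; exact: integ_mul.
- by move=> t /normE ->; ring.
rewrite JC Ipi_int_cos_cos// subrr cos0 mulr0 add0r addr0 mulr1 => /eqP.
have pi0 := @pi_gt0 R.
rewrite mulf_eq0 (gt_eqF pi0) orbF /q => q0.
(* Because [d < 2], the factor [1 - 4 / d ^ 2] of [q] is nonzero; [r = 0] together with [n = 0]
   contradicts the norm [2 * pi]. *)
have r0 : r = 0.
  move: q0; rewrite -mulrA mulf_eq0 sqrf_eq0 => /orP[/eqP//|].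
  have h : 1 < 4 / d ^+ 2.
    rewrite ltr_pdivlMr ?exprn_gt0//; last lra.
    by rewrite mul1r expr2; nra.
  by rewrite mulf_eq0 invr_eq0 pnatr_eq0 orbF lt_eqF ?subr_lt0.
rewrite L2 r0 n0 !expr0n/= !mulr0 mul0r addr0 => /eqP.
by rewrite gt_eqF// mulr_gt0.
Qed.

End EqualityCases.

Theorem mainTheorem3 (R : realType) (k2 : R) (hk : 0 < k2) :
  (forall u du : R -> vec3 R, H1sharp3 u du ->
     c2 k2 * L2sq u <= energy k2 u du)
  /\
  (forall u du : R -> vec3 R, H1sharp3 u du ->
     L2sq u / (2 * pi) = 1 ->
     (energy k2 u du = c2 k2 * L2sq u <-> equality_case k2 u))
  /\
  (k2 < 3 -> forall u du : R -> vec3 R, H1sharp3 u du ->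
     {ae @leb R, forall t, @Ipi R t -> vnorm2 (u t) = 1} ->
     energy k2 u du <> c2 k2 * L2sq u).
Proof.
have pi0 : 2 * pi != 0 :> R by rewrite mulf_neq0 ?pnatr_eq0// gt_eqF// pi_gt0.
split; first by move=> u du; exact: energy_ge.
split.
  move=> u du Hu /(congr1 ( *%R^~ (2 * pi))); rewrite /= mul1r divfK// => L.
  by rewrite (energy_eqP hk Hu); exact: equality_caseP.
move=> k3 u du Hu ae1 /(energy_eqP hk Hu)[r [theta [n [_ _ ext]]]].
exact: extremal_not_unit hk k3 ext ae1.
Qed.
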